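(* Let $h$ be a locally projectively flat Riemannian metric on a manifold of dimension $n\ge2$ and let $W$ be a conformal vector field with respect to $h$. If the 1-form $W^\flat$ dual to $W$ with respect to $h$ is closed, then there is a local coordinate system in which $h$ is given by $$h=\frac{\sqrt{(1+\mu|x|^2)|y|^2-\mu\langle x,y\rangle^2}}{1+\mu|x|^2}$$ and $$W=\sqrt{1+\mu|x|^2}\,(\lambda x+a),$$ where $\mu,\lambda$ are constants and $a\in\mathbb R^n$ is a constant vector. In this case, $$W^\flat=\frac{\lambda\langle x,y\rangle+(1+\mu|x|^2)\langle a,y\rangle-\mu\langle a,x\rangle\langle x,y\rangle}{(1+\mu|x|^2)^{3/2}}.$$
   Context: A Riemannian metric $h$ is identified with its norm $h(x,y)=\sqrt{h_{ij}(x)y^iy^j}$ on tangent vectors $y\in T_xM$; $|\cdot|$ and $\langle\cdot,\cdot\rangle$ are the Euclidean norm and inner product in the coordinates. $h$ is locally projectively flat if around every point there is a local coordinate system in which all geodesics are straight lines (as point sets). $W^\flat(y)=h_{ij}W^iy^j$. $W$ is conformal with respect to $h$ if $\mathcal L_W(h_{ij}\,dx^i dx^j)=2c(x)\,h_{ij}\,dx^i dx^j$ for some scalar function $c$. *)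

(* Defs.v *)
From mathcomp Require Import all_boot all_order all_algebra.
From mathcomp Require Import all_classical all_reals all_analysis.
Import Order.TTheory GRing.Theory Num.Theory.
Import numFieldNormedType.Exports.

Set Implicit Arguments.
Unset Strict Implicit.
Unset Printing Implicit Defensive.

Local Open Scope classical_set_scope.
Local Open Scope ring_scope.

(* C^k in the sense of Frechet: for all k together this is C^oo, since a
   function whose iterated directional derivatives are all differentiable has
   continuous partial derivatives of every order, and conversely.
   [U] is meant to be open. *)
Fixpoint diff_times {R : realType} {V W : normedModType R} (k : nat)
    (U : set V) (f : V -> W) : Prop :=
  if k is k'.+1 then
    (forall x, U x -> differentiable f x) /\
    (forall v : V, diff_times k' U ('D_v f))
  else forall x, U x -> {for x, continuous f}.

Definition smooth_on {R : realType} {V W : normedModType R}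
    (U : set V) (f : V -> W) : Prop :=
  forall k, diff_times k U f.

Definition partial {R : realType} {n : nat} {W : normedModType R}
    (i : 'I_n) (f : 'rV[R]_n -> W) : 'rV[R]_n -> W :=
  'D_(delta_mx 0 i) f.

(* The library norm `|x| on 'rV[R]_n is the sup norm, hence these. *)
Definition dotp {R : realType} {n : nat} (x y : 'rV[R]_n) : R :=
  \sum_i x 0 i * y 0 i.

Definition enorm {R : realType} {n : nat} (x : 'rV[R]_n) : R :=
  Num.sqrt (dotp x x).

(* [cfun] only matters on [cdom], and [cinv] on the image of [cdom]. *)
Record chart (R : realType) (n : nat) (M : topologicalType) := Chart {
  cdom : set M;
  cfun : M -> 'rV[R]_n;
  cinv : 'rV[R]_n -> M;
  cdom_open : open cdom;
  cimg_open : open (cfun @` cdom);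
  cfun_continuous : {within cdom, continuous cfun};
  cinv_continuous : {within cfun @` cdom, continuous cinv};
  cfunK : forall p, cdom p -> cinv (cfun p) = p
}.

Definition cimg {R : realType} {n : nat} {M : topologicalType}
    (phi : chart R n M) : set 'rV[R]_n := cfun phi @` cdom phi.

Definition transition {R : realType} {n : nat} {M : topologicalType}
    (phi psi : chart R n M) : 'rV[R]_n -> 'rV[R]_n :=
  fun x => cfun psi (cinv phi x).

Definition overlap {R : realType} {n : nat} {M : topologicalType}
    (phi psi : chart R n M) : set 'rV[R]_n :=
  cfun phi @` (cdom phi `&` cdom psi).

Definition compatible {R : realType} {n : nat} {M : topologicalType}
    (phi psi : chart R n M) : Prop :=
  smooth_on (overlap phi psi) (transition phi psi) /\
  smooth_on (overlap psi phi) (transition psi phi).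

Record manifold (R : realType) (n : nat) := Manifold {
  points :> topologicalType;
  atlas : set (chart R n points);
  points_hausdorff : hausdorff_space points;
  points_second_countable : @second_countable points;
  atlas_cover : forall p, exists2 phi, atlas phi & cdom phi p;
  atlas_compatible :
    forall phi psi, atlas phi -> atlas psi -> compatible phi psi
}.

(* The charts of the maximal atlas. *)
Definition local_coords {R : realType} {n : nat} (M : manifold R n)
    (phi : chart R n M) : Prop :=
  forall psi, atlas psi -> compatible phi psi.

Definition quad {R : realType} {n : nat} (A : 'M[R]_n) (y : 'rV[R]_n) : R :=
  \sum_i \sum_j A i j * y 0 i * y 0 j.

(* Tensor fields are given by their components in all local coordinate systems,
   subject to the transformation law; values on charts outside the maximal
   atlas, or off the image of the chart, are irrelevant.  Vectors are rows, so
   a tangent vector y transforms as y *m 'J tau x (lemma [deriveEjacobian]). *)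
Record riemannian_metric (R : realType) (n : nat) (M : manifold R n) :=
  RiemannianMetric {
  metric :> chart R n M -> 'rV[R]_n -> 'M[R]_n;
  metric_smooth : forall phi, local_coords phi ->
    smooth_on (cimg phi) (metric phi);
  metric_sym : forall phi, local_coords phi ->
    forall x, cimg phi x -> (metric phi x)^T = metric phi x;
  metric_posdef : forall phi, local_coords phi ->
    forall x, cimg phi x -> forall y, y != 0 -> 0 < quad (metric phi x) y;
  metric_transition : forall phi psi, local_coords phi -> local_coords psi ->
    forall x, overlap phi psi x ->
      let J := 'J (transition phi psi) x in
      metric phi x = J *m metric psi (transition phi psi x) *m J^T
}.

Record vector_field (R : realType) (n : nat) (M : manifold R n) :=
  VectorField {
  vfield :> chart R n M -> 'rV[R]_n -> 'rV[R]_n;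
  vfield_smooth : forall phi, local_coords phi ->
    smooth_on (cimg phi) (vfield phi);
  vfield_transition : forall phi psi, local_coords phi -> local_coords psi ->
    forall x, overlap phi psi x ->
      vfield psi (transition phi psi x) =
      vfield phi x *m 'J (transition phi psi) x
}.

Section Geometry.
Context {R : realType} {n : nat} {M : manifold R n}.
Implicit Types (h : riemannian_metric M) (W : vector_field M).
Implicit Types (phi : chart R n M) (x y : 'rV[R]_n).

Definition metric_norm h phi x y : R := Num.sqrt (quad (h phi x) y).

Definition christoffel h phi x (k i j : 'I_n) : R :=
  2^-1 * \sum_l invmx (h phi x) k l *
    (partial i (fun z => h phi z j l) x + partial j (fun z => h phi z i l) x
     - partial l (fun z => h phi z i j) x).

(* [I] is an open interval, possibly unbounded. *)
Definition geodesic h phi (I : set R) (g : R -> 'rV[R]_n) : Prop :=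
  [/\ open I, is_interval I &
    forall t, I t ->
    [/\ cimg phi (g t), derivable g t 1, derivable (derive1 g) t 1 &
      forall k, derive1n 2 g t 0 k +
        \sum_i \sum_j
          christoffel h phi (g t) k i j * derive1 g t 0 i * derive1 g t 0 j = 0]].

Definition straight (A : set 'rV[R]_n) : Prop :=
  exists p v : 'rV[R]_n, exists2 J : set R,
    is_interval J & A = [set p + s *: v | s in J].

Definition locally_projectively_flat h : Prop :=
  forall p : M, exists phi,
    [/\ local_coords phi, cdom phi p &
      forall I g, geodesic h phi I g -> straight (g @` I)].

Definition lie_metric W h phi x (i j : 'I_n) : R :=
  \sum_k (W phi x 0 k * partial k (fun z => h phi z i j) x
          + h phi x k j * partial i (fun z => W phi z 0 k) x
          + h phi x i k * partial j (fun z => W phi z 0 k) x).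

Definition conformal h W : Prop :=
  exists c : M -> R, forall phi, local_coords phi ->
    forall x, cimg phi x -> forall i j,
      lie_metric W h phi x i j = 2 * c (cinv phi x) * h phi x i j.

(* Components of the dual 1-form and its value on a tangent vector. *)
Definition flat h W phi x (j : 'I_n) : R := \sum_i h phi x i j * W phi x 0 i.

Definition flat_eval h W phi x y : R := \sum_j flat h W phi x j * y 0 j.

Definition closed_form (omega : chart R n M -> 'rV[R]_n -> 'I_n -> R) : Prop :=
  forall phi, local_coords phi -> forall x, cimg phi x -> forall i j,
    partial i (fun z => omega phi z j) x = partial j (fun z => omega phi z i) x.

End Geometry.

(* Main.v *)
Require Import Defs.
From mathcomp Require Import all_boot all_order all_algebra.
From mathcomp Require Import all_classical all_reals all_analysis.
From mathcomp Require Import ring lra perm.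
Import Order.TTheory GRing.Theory Num.Theory.
Import numFieldNormedType.Exports.
Set Implicit Arguments.
Unset Strict Implicit.
Unset Printing Implicit Defensive.
Local Open Scope classical_set_scope.
Local Open Scope ring_scope.

(** Fix a point and coordinates around it in which geodesics are straight lines.
    Through every point and in every direction there is a geodesic
    ([geodesic_exists], from the local solvability of ordinary differential
    equations, [picard]); as it is straight, its acceleration is parallel to its
    velocity ([straight_acceleration]).  So the Christoffel symbols, as quadratic
    maps, multiply each vector by a scalar, which forces them to be
    [delta^k_i psi_j + delta^k_j psi_i] ([projective_symbols]).  The metric then
    satisfies
    [d_k h_ij = 2 psi_k h_ij + psi_i h_kj + psi_j h_ik]
    ([projective_metric_derivative]).

    Taking the trace, [psi] is the differential of [f = ln (det h) / (2 (n + 1))].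
    The rescaled inverse metric [sigma = e^(2 f) h^-1] satisfies the linear
    equation [d_k sigma^ij = delta_k^i w^j + delta_k^j w^i], whose solutions are
    quadratic polynomials [A + u^T b + b^T u + c u^T u] in the displacement [u]
    ([metrisability_quadratic]).  No curvature tensor appears, and the equation is
    integrated without second derivatives: on a box, a function whose other
    partial derivatives vanish depends on a few coordinates only, and each
    constancy claim is obtained by letting one quantity depend on two disjoint
    sets of coordinates.  Here [n >= 2] enters.  The Lie derivative condition gives
    the symmetric part of the covariant derivative of [W] and the closedness of
    its dual form the antisymmetric part; it follows in the same way that
    [e^f W = a0 + l0 u] ([conformal_field_affine]).

    It remains to normalise.  Choose a frame [C] orthonormal for [h] at the centre
    and put [y = u C^-1], [beta = b C^-1], [mu = c - |beta|^2].  Completing the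
    square ([quadratic_factor]) writes [sigma] as
    [C^T L^T (1 + mu z^T z) L C] with [L = 1 + beta^T y] and
    [z = y / (1 + beta.y)], and [L C] is, up to a factor, the differential of the
    inverse of the projective map [u |-> z].  Comparing determinants identifies
    the conformal factor [e^(-2 f)] ([klein_scale]); so in the coordinate [z] the
    metric has the required form ([klein_metric]), and the affine field
    [a0 + l0 u] becomes the required one ([klein_field]).  Finally [z] is a
    legitimate coordinate because the projective map is a diffeomorphism of open
    sets ([recoordinate]). *)

(** * Coordinates, mean values and primitives *)

Section Calculus.
Context {R : realType}.

Lemma coord_le_norm m n (A : 'M[R]_(m, n)) i j : `|A i j| <= `|A|.
Proof.
rewrite [leRHS]/Num.Def.normr /= mx_normrE; exact: (le_bigmax _ _ (i, j)).
Qed.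

Lemma norm_le_coord m n (A : 'M[R]_(m, n)) e :
  0 <= e -> (forall i j, `|A i j| <= e) -> `|A| <= e.
Proof.
move=> e0 Ae; rewrite [leLHS]/Num.Def.normr /= mx_normrE.
by apply: bigmax_le => // -[i j] _; apply: Ae.
Qed.

Lemma continuous_rowP (T : topologicalType) n (f : T -> 'rV[R]_n) x :
  (forall i, {for x, continuous (fun y => f y 0 i)}) -> {for x, continuous f}.
Proof.
move=> cf; apply/cvgrPdist_le => e e0.
have : \forall y \near x, forall i, `|f x 0 i - f y 0 i| <= e.
  by apply: filter_forall => i; move/cvgrPdist_le: (cf i) => /(_ e e0).
apply: filterS => y fy; apply: norm_le_coord => [|i j]; first exact: ltW.
by rewrite ord1 !mxE.
Qed.

Lemma is_derive_rowP (V : normedModType R) n (f : V -> 'rV[R]_n) x v df :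
  is_derive x v f df <->
  forall i, is_derive x v (fun y => f y 0 i : R) (df 0 i).
Proof.
split=> [[fd fE] i|H].
  have fi := (derivable_mxP f x v).1 fd 0 i.
  by apply: DeriveDef => //; rewrite -fE derive_mx // mxE.
have fd : derivable f x v.
  by apply/derivable_mxP => i j; rewrite ord1; have [] := H j.
apply: DeriveDef => //; rewrite derive_mx //.
by apply/rowP => i; rewrite mxE; have [_] := H i.
Qed.

Lemma is_derive1_continuous n (f : R -> 'rV[R]_n) t df :
  is_derive t (1 : R) f df -> {for t, continuous f}.
Proof.
by move=> [fd _]; apply/differentiable_continuous/derivable1_diffP.
Qed.

(** Comparing with a linear map of slope [a] lets one estimate serve as a Lipschitz
    bound ([a = 0]), as a criterion of affineness ([K = 0]) and for computing a
    derivative. *)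
Lemma mvt_norm n (v v' : R -> 'rV[R]_n) (a : 'rV[R]_n) (K t t' : R) :
  (forall s, Num.min t t' <= s <= Num.max t t' ->
     is_derive s (1 : R) v (v' s) /\ `|v' s - a| <= K) ->
  `|v t - v t' - (t - t') *: a| <= K * `|t - t'|.
Proof.
wlog tt' : t t' / t' <= t => [hwlog|].
  move=> H; have [tt'|tt'] := leP t' t; first exact: hwlog.
  rewrite -normrN opprB [ `|t - t'|]distrC.
  rewrite (_ : _ - _ = v t' - v t - (t' - t) *: a); last first.
    by apply/rowP => i; rewrite !mxE; ring.
  by apply: hwlog (ltW tt') _ => s; rewrite minC maxC; apply: H.
rewrite (min_idPr tt') (max_idPl tt') => H.
have K0 : 0 <= K.
  by have [|_] := H t; [rewrite lexx tt'|apply: le_trans].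
apply: norm_le_coord => [|i j]; first exact: mulr_ge0.
rewrite ord1 {i}.
have D s : t' <= s <= t -> is_derive s (1 : R) (fun y => v y 0 j) (v' s 0 j).
  by move=> /H[/is_derive_rowP dv _].
have [s||c cI E] := @MVT_segment R (fun y => v y 0 j) (fun s => v' s 0 j) t' t tt'.
- by rewrite in_itv /= => /andP[s1 s2]; apply: D; rewrite !ltW.
- apply: continuous_in_subspaceT => s; rewrite inE /= in_itv /= => sI.
  have [dvs _] := D s sI.
  by apply/differentiable_continuous/derivable1_diffP.
move: cI; rewrite in_itv /= => cI; have [_ vK] := H c cI.
rewrite !mxE E [(t - t') * _]mulrC -mulrBl normrM ler_wpM2r //.
by apply: le_trans vK; have := coord_le_norm (v' c - a) 0 j; rewrite !mxE.
Qed.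

(** The integral starts at -1 so that 0 is an interior point. *)
Lemma primitive_exists (f : R -> R) : continuous f ->
  exists F : R -> R, F 0 = 0 /\ forall t, `|t| < 1 -> is_derive t (1 : R) F (f t).
Proof.
move=> cf; pose mu := @lebesgue_measure R.
have fi : mu.-integrable `[-1, 1] (EFin \o f).
  apply: continuous_compact_integrable; first exact: segment_compact.
  exact: continuous_subspaceT.
pose F x := (\int[mu]_(t in `[(-1 : R), x]) f t)%R.
exists (fun x => F x - F 0); split=> [|t]; first by rewrite subrr.
rewrite ltr_norml => /andP[t1 t2].
have [dF FE] := @continuous_FTC1_closed R f (-1) t 1 t2 fi t1 (cf t).
have dF' : is_derive t (1 : R) F (f t).
  exact: (DeriveDef dF (etrans (esym (derive1E F t)) FE)).
by rewrite -[f t]subr0; apply: is_deriveB.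
Qed.

(** The lower bounds [a k - e k] increase and the upper bounds [a k + e k] decrease;
    the limit is the supremum of the lower bounds. *)
Lemma geometric_cvg (a : nat -> R) C : 0 <= C ->
  (forall k, `|a k.+1 - a k| <= C * 2^-1 ^+ k) ->
  exists l, forall k, `|a k - l| <= 2 * C * 2^-1 ^+ k.
Proof.
move=> C0 aC; pose e k := 2 * C * 2^-1 ^+ k.
have e0 k : 0 <= e k by rewrite /e !mulr_ge0 ?exprn_ge0 ?invr_ge0.
have eS k : e k = e k.+1 + C * 2^-1 ^+ k.
  by rewrite /e exprS; field.
have up k m : a (k + m)%N - e (k + m)%N >= a k - e k.
  elim: m => [|m IH]; first by rewrite addn0.
  apply: le_trans IH _; rewrite addnS.
  by have := aC (k + m)%N; have := eS (k + m)%N; rewrite ler_norml; lra.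
have dn k m : a (k + m)%N + e (k + m)%N <= a k + e k.
  elim: m => [|m IH]; first by rewrite addn0.
  apply: le_trans IH; rewrite addnS.
  by have := aC (k + m)%N; have := eS (k + m)%N; rewrite ler_norml; lra.
have ub k m : a k - e k <= a m + e m.
  have [km|mk] := leqP k m.
    rewrite -(subnKC km); apply: le_trans (up k (m - k)%N) _.
    by have := e0 (k + (m - k))%N; lra.
  rewrite -{1 2}(subnKC (ltnW mk)); apply: le_trans (dn m (k - m)%N).
  by have := e0 (m + (k - m))%N; lra.
pose A := [set a k - e k | k in setT].
have A0 : A !=set0 by exists (a 0%N - e 0%N), 0%N.
have Aub m : ubound A (a m + e m) by move=> _ [k _ <-].
exists (sup A) => k; rewrite ler_norml.
have s1 : sup A <= a k + e k by apply: ge_sup.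
have s2 : a k - e k <= sup A.
  by apply: ub_le_sup; [exists (a 0%N + e 0%N)|exists k].
by rewrite -/(e k); lra.
Qed.

End Calculus.

(** * Local solutions of ordinary differential equations *)

Section ODE.
Context {R : realType}.

Definition clamp (a r x : R) : R := Num.max (a - r) (Num.min (a + r) x).

Lemma clampE a r x : 0 <= r ->
  [\/ clamp a r x = a - r /\ x <= a - r, clamp a r x = a + r /\ a + r <= x
    | clamp a r x = x /\ (a - r <= x <= a + r)].
Proof.
rewrite /clamp => r0; have [h1|h1] := leP (a + r) x.
  have [h2|h2] := leP (a - r) (a + r); first by constructor 2.
  by lra.
have [h2|h2] := leP (a - r) x; last by constructor 1; split => //; lra.
by constructor 3; split => //; lra.
Qed.

Lemma clamp_lipschitz a r x y : 0 <= r -> `|clamp a r x - clamp a r y| <= `|x - y|.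
Proof.
move=> r0; have := ler_norm (x - y); have := ler_norm (y - x).
rewrite [ `|y - x|]distrC; move: `|x - y| => d yx xy.
by case: (clampE a x r0) => -[-> ?]; case: (clampE a y r0) => -[-> ?];
  rewrite ler_norml; apply/andP; split; lra.
Qed.

Lemma clamp_near a r x : 0 <= r -> `|clamp a r x - a| <= r.
Proof.
by move=> r0; case: (clampE a x r0) => -[-> ?]; rewrite ler_norml; lra.
Qed.

Lemma clamp_id a r x : `|x - a| <= r -> clamp a r x = x.
Proof.
move=> h; have r0 : 0 <= r by apply: le_trans h.
by move: h; rewrite ler_norml; case: (clampE a x r0) => -[-> ?] //; lra.
Qed.

Lemma clamp_continuous a r : 0 <= r -> continuous (clamp a r).
Proof.
move=> r0 x; apply/cvgrPdist_le => e e0; near=> y.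
apply: le_trans (clamp_lipschitz _ _ _ r0) _.
by near: y; move: e e0; apply/cvgrPdist_le.
Unshelve. all: by end_near. Qed.

(** Clamping the time makes the primitive continuous on the whole line, so that
    this step can be iterated. *)
Lemma primitive_row n (x0 : 'rV[R]_n) (w : R -> 'rV[R]_n) : continuous w ->
  exists v : R -> 'rV[R]_n, [/\ continuous v, v 0 = x0 &
    forall t, `|t| < 2^-1 -> is_derive t (1 : R) v (w t)].
Proof.
move=> cw.
have /choice[F FP] : forall i, exists F : R -> R, F 0 = 0 /\
    forall t, `|t| < 1 -> is_derive t (1 : R) F (w t 0 i).
  move=> i; apply: primitive_exists => t.
  exact: (@continuous_comp _ _ _ w (fun A : 'rV[R]_n => A 0 i) t (cw t)
    (@coord_continuous R 1 n 0 i (w t))).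
pose f t : 'rV[R]_n := x0 + \row_i F i t.
have df t : `|t| < 1 -> is_derive t (1 : R) f (w t).
  move=> t1; apply/is_derive_rowP => i.
  rewrite (_ : (fun y => _) = cst (x0 0 i) + F i); last first.
    by apply/funext => y; rewrite /f !mxE.
  by rewrite -[w t 0 i]add0r; apply: is_deriveD; have [_] := FP i; apply.
exists (fun t => f (clamp 0 2^-1 t)); split.
- move=> t; apply: continuous_comp; first by apply: clamp_continuous; lra.
  apply: is_derive1_continuous; apply: df.
  have : `|clamp 0 2^-1 t - 0| <= 2^-1 by apply: clamp_near; lra.
  by rewrite subr0; lra.
- rewrite clamp_id ?subrr ?normr0; last by lra.
  by apply/rowP => i; rewrite /f !mxE; have [->] := FP i; rewrite addr0.
- move=> t t2; apply: (@near_eq_is_derive _ _ _ f); last first.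
    by apply: df; lra.
  near=> s; rewrite clamp_id // subr0; apply: ltW; near: s.
  have /cvgr_lt := @norm_continuous _ _ t; exact.
Unshelve. all: by end_near. Qed.

Lemma geometric_cvg_row n (a : nat -> 'rV[R]_n) C : 0 <= C ->
  (forall k, `|a k.+1 - a k| <= C * 2^-1 ^+ k) ->
  exists l, forall k, `|a k - l| <= 2 * C * 2^-1 ^+ k.
Proof.
move=> C0 aC.
have /choice[l lP] : forall i, exists l, forall k,
    `|a k 0 i - l| <= 2 * C * 2^-1 ^+ k.
  move=> i; apply: geometric_cvg => // k; apply: le_trans (aC k).
  by have := coord_le_norm (a k.+1 - a k) 0 i; rewrite !mxE.
exists (\row_i l i) => k; apply: norm_le_coord => [|i j].
  by rewrite !mulr_ge0 ?exprn_ge0 ?invr_ge0.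
by rewrite ord1 !mxE.
Qed.

(** The criterion that survives a pointwise limit: the hypothesis is a family of
    closed inequalities. *)
Lemma is_derive_quadratic n (u : R -> 'rV[R]_n) t a K e : 0 < e ->
  (forall s, `|s - t| < e -> `|u s - u t - (s - t) *: a| <= K * `|s - t| ^+ 2) ->
  is_derive t (1 : R) u a.
Proof.
move=> e0 H.
suff cu : h^-1 *: ((u \o shift t) (h *: (1 : R)) - u t) @[h --> 0^'] --> a.
  by apply: DeriveDef; [apply/cvg_ex; exists a|apply/cvg_lim].
apply/cvgrPdist_le => d d0; near=> h.
have h0 : h != 0 by near: h; exact: nbhs_dnbhs_neq.
have he : `|h| < e by near: h; exact: dnbhs0_lt.
have hd : `|h| < d / (`|K| + 1).
  by near: h; apply: dnbhs0_lt; rewrite divr_gt0 // ltr_wpDl.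
have := H (h + t); rewrite addrK => /(_ he) Hh.
rewrite distrC /= [h *: _]mulr1.
rewrite -[a]scale1r -(mulVf h0) -scalerA -scalerBr normrZ normfV.
rewrite ler_pdivrMl ?normr_gt0 //; apply: le_trans Hh _.
rewrite expr2 mulrCA ler_wpM2l //.
apply: le_trans (_ : (`|K| + 1) * `|h| <= d); last first.
  by rewrite mulrC -ler_pdivlMr ?ltW // ltr_wpDl.
by rewrite ler_wpM2r //; have := ler_norm K; lra.
Unshelve. all: by end_near. Qed.

Lemma near_dist_le (V : normedModType R) (x : V) d : 0 < d ->
  \forall y \near x, `|x - y| <= d.
Proof.
by move=> d0; apply/nbhs_ballP; exists d => // y; rewrite -ball_normE => /ltW.
Qed.

Lemma lipschitz_continuous (V W : normedModType R) (G : V -> W) L :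
  (forall x y, `|G x - G y| <= L * `|x - y|) -> continuous G.
Proof.
move=> GL x; apply/cvgrPdist_le => e e0; near=> y.
apply: le_trans (GL _ _) _.
apply: le_trans (_ : (`|L| + 1) * `|x - y| <= e).
  by rewrite ler_wpM2r //; have := ler_norm L; lra.
rewrite mulrC -ler_pdivlMr ?ltr_wpDl //; near: y.
have d0 : 0 < e / (`|L| + 1) by rewrite divr_gt0 // ltr_wpDl.
exact: near_dist_le.
Unshelve. all: by end_near. Qed.

(** Picard iteration.  For [|t| < T] with [L T <= 1/2] consecutive iterates differ
    by at most [C 2^-k].  Up to a geometric error every iterate satisfies the
    quadratic estimate of [is_derive_quadratic], which therefore holds for the
    limit. *)
Lemma picard_global n (G : 'rV[R]_n -> 'rV[R]_n) x0 L : 0 < L ->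
  (forall x y, `|G x - G y| <= L * `|x - y|) ->
  exists (T : R) (u : R -> 'rV[R]_n), [/\ 0 < T, u 0 = x0 &
    forall t, `|t| < T -> is_derive t (1 : R) u (G (u t))].
Proof.
move=> L0 GL.
have cG := lipschitz_continuous GL.
have /choice[I IP] : forall w : R -> 'rV[R]_n, exists v : R -> 'rV[R]_n,
    continuous w -> [/\ continuous v, v 0 = x0 &
      forall t, `|t| < 2^-1 -> is_derive t (1 : R) v (G (w t))].
  move=> w; have [cw|ncw] := pselect (continuous w); last by exists w.
  have [|v vP] := @primitive_row n x0 (G \o w); last by exists v.
  by move=> t; apply: continuous_comp; [exact: cw|exact: cG].
pose u k := iter k I (cst x0).
have cu k : continuous (u k).
  elim: k => [|k IH] /=; first exact: cst_continuous.
  by have [] := IP _ IH.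
have u0 k : u k 0 = x0 by case: k => [|k] //=; have [] := IP _ (cu k).
have du k t : `|t| < 2^-1 -> is_derive t (1 : R) (u k.+1) (G (u k t)).
  by have [_ _] := IP _ (cu k); apply.
pose T := Num.min 2^-1 (2^-1 / L).
have T0 : 0 < T by rewrite lt_min divr_gt0 ?invr_gt0 // ltr0n.
have T2 : T <= 2^-1 by rewrite ge_min lexx.
have TL : L * T <= 2^-1 by rewrite mulrC -ler_pdivlMr // ge_min lexx orbT.
have btw t s : `|t| < T -> Num.min t 0 <= s <= Num.max t 0 -> `|s| <= `|t| /\ `|s| < T.
  move=> tT; rewrite ge_min le_max => /andP[/orP sI1 /orP sI2].
  suff st : `|s| <= `|t| by split=> //; exact: le_lt_trans tT.
  rewrite ler_norml; have := ler_norm t; have := ler_norm (- t); rewrite normrN.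
  by case: sI1 => ?; case: sI2 => ?; lra.
pose C := `|G x0|.
have C0 : 0 <= C by exact: normr_ge0.
have step k t : `|t| < T -> `|u k.+1 t - u k t| <= C * 2^-1 ^+ k.
  elim: k t => [|k IH] t tT.
    have := @mvt_norm R n (u 1%N) (fun s => G (u 0%N s)) 0 C t 0.
    rewrite subr0 scaler0 subr0 u0 expr0 mulr1 => H.
    apply: le_trans (H _) _ => [s /(btw _ _ tT)[_ sT]|].
      split; last by rewrite subr0.
      by apply: du; exact: lt_le_trans T2.
    by rewrite ler_piMr //; apply: ltW; apply: lt_le_trans tT _; lra.
  have := @mvt_norm R n (fun s => u k.+2 s - u k.+1 s) (fun s => G (u k.+1 s) - G (u k s)) 0
    (L * (C * 2^-1 ^+ k)) t 0.
  rewrite scaler0 !u0 subrr !subr0 => H.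
  apply: le_trans (H _) _ => [s /(btw _ _ tT)[_ sT]|].
    split; last first.
      by rewrite subr0; apply: le_trans (GL _ _) _; rewrite ler_pM2l // IH.
    by apply: is_deriveB; apply: du; exact: lt_le_trans T2.
  rewrite exprS [C * (_ * _)]mulrCA mulrAC ler_wpM2r //.
    by rewrite mulr_ge0 // exprn_ge0 // invr_ge0.
  by apply: le_trans TL; rewrite ler_wpM2l // ?ltW.
have /choice[v vP] : forall t, exists l, `|t| < T ->
    forall k, `|u k t - l| <= 2 * C * 2^-1 ^+ k.
  move=> t; have [tT|ntT] := pselect (`|t| < T); last by exists 0.
  have [l lP] := geometric_cvg_row C0 (fun k => step k t tT).
  by exists l.
have pow_small (A B e : R) : (forall k, A <= B + e * 2^-1 ^+ k) -> A <= B.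
  move=> H; apply/ler_addgt0Pr => d d0.
  have c0 : e * 2^-1 ^+ k @[k --> \oo] --> 0.
    rewrite -(mulr0 e); apply: cvgMr; apply: cvg_expr.
    by rewrite ger0_norm ?invf_lt1 ?ltr1n.
  have /cvgrPdist_le/(_ d d0)[k _ /(_ k (leqnn _))] := c0.
  by rewrite /= sub0r normrN => Hk; apply: le_trans (H k) _; rewrite lerD2l;
    apply: le_trans Hk; exact: ler_norm.
have v0 : v 0 = x0.
  have := vP 0; rewrite normr0 => /(_ T0) H.
  apply/esym/eqP; rewrite -subr_eq0 -normr_le0.
  by apply: (@pow_small _ _ (2 * C)) => k; rewrite add0r -(u0 k).
(* [u k t] stays at distance [4 C] from [x0], so [M] bounds all the velocities. *)
pose M := C + L * (4 * C).
have GM k t : `|t| < T -> `|G (u k t)| <= M.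
  move=> tT; rewrite -[G _](subrK (G x0)) addrC; apply: le_trans (ler_normD _ _) _.
  rewrite lerD2l; apply: le_trans (GL _ _) _; rewrite ler_pM2l //.
  rewrite -(subrKA (v t)); apply: le_trans (ler_normD _ _) _.
  rewrite [ `|v t - x0|]distrC.
  have h2 := vP t tT 0%N; rewrite /u /= expr0 mulr1 /cst in h2.
  have h1 := vP t tT k.
  have h3 : 2 * C * 2^-1 ^+ k <= 2 * C.
    by rewrite ler_piMr ?mulr_ge0 // exprn_ile1 // ?invr_ge0 // invf_le1 // ler1n.
  by lra.
have btw' t s r : `|t| < T -> `|s| < T -> Num.min s t <= r <= Num.max s t ->
    `|r| < T /\ `|r - t| <= `|s - t|.
  rewrite ge_min le_max => tT sT /andP[/orP rI1 /orP rI2].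
  have := ler_norm (s - t); have := ler_norm (t - s); rewrite distrC.
  move: tT sT; rewrite !ltr_norml ler_norml.
  by case: rI1 => ?; case: rI2 => ?; lra.
have uM k t s : `|t| < T -> `|s| < T -> `|u k.+1 s - u k.+1 t| <= M * `|s - t|.
  move=> tT sT.
  have := @mvt_norm R n (u k.+1) (fun s => G (u k s)) 0 M s t.
  rewrite scaler0 subr0; apply => r /(btw' _ _ _ tT sT)[rT _].
  by split; [apply: du; exact: lt_le_trans T2|rewrite subr0 GM].
have tri k t s : `|t| < T -> `|s| < T -> forall a,
    `|v s - v t - a| <= `|u k s - u k t - a| + 4 * C * 2^-1 ^+ k.
  move=> tT sT a.
  rewrite (_ : v s - v t - a = (u k s - u k t - a) - (u k s - v s) + (u k t - v t)); last first.
    by apply/rowP => i; rewrite !mxE; ring.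
  apply: le_trans (ler_normD _ _) _.
  have := ler_normB (u k s - u k t - a) (u k s - v s).
  by have := vP t tT k; have := vP s sT k; lra.
have vM t s : `|t| < T -> `|s| < T -> `|v s - v t| <= M * `|s - t|.
  move=> tT sT; apply: (@pow_small _ _ (2 * C)) => k.
  have := tri k.+1 _ _ tT sT 0; rewrite !subr0 exprS.
  have := uM k _ _ tT sT.
  by rewrite (_ : 4 * C * (2^-1 * _) = 2 * C * 2^-1 ^+ k); [lra|field].
exists T, v; split=> // t tT.
apply: (@is_derive_quadratic _ _ _ _ (L * M) (T - `|t|)); first by rewrite subr_gt0.
move=> s sT'.
have sT : `|s| < T.
  by have := ler_normD (s - t) t; rewrite subrK; lra.
apply: (@pow_small _ _ (L * (2 * C) * `|s - t| + 2 * C)) => k.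
apply: le_trans (tri k.+1 _ _ tT sT _) _.
have h : `|u k.+1 s - u k.+1 t - (s - t) *: G (v t)|
    <= L * (2 * C * 2^-1 ^+ k + M * `|s - t|) * `|s - t|.
  apply: (@mvt_norm R n (u k.+1) (fun s => G (u k s))).
  move=> r /(btw' _ _ _ tT sT)[rT rt]; split.
    by apply: du; exact: lt_le_trans T2.
  apply: le_trans (GL _ _) _; rewrite ler_pM2l //.
  rewrite -(subrKA (v r)); apply: le_trans (ler_normD _ _) _.
  apply: lerD; first exact: vP.
  apply: le_trans (vM _ _ tT rT) _; rewrite ler_wpM2l //.
  by have := mulr_ge0 (ltW L0) C0; rewrite /M; lra.
rewrite [_ ^+ k.+1]exprS.
rewrite (_ : 4 * C * (2^-1 * _) = 2 * C * 2^-1 ^+ k); last by field.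
by apply: le_trans (lerD h (lexx _)) _; rewrite le_eqVlt; apply/orP; left;
  apply/eqP; ring.
Qed.

(** Outside the ball the field is replaced by its value at the clamped point;
    the solution stays in the ball for a short time, by continuity. *)
Lemma picard n (F : 'rV[R]_n -> 'rV[R]_n) x0 r L : 0 < r -> 0 < L ->
  (forall x y, `|x - x0| <= r -> `|y - x0| <= r -> `|F x - F y| <= L * `|x - y|) ->
  exists (T : R) (u : R -> 'rV[R]_n), [/\ 0 < T, u 0 = x0 &
    forall t, `|t| < T -> `|u t - x0| <= r /\ is_derive t (1 : R) u (F (u t))].
Proof.
move=> r0 L0 FL; have r0' := ltW r0.
pose cl (x : 'rV[R]_n) : 'rV[R]_n := \row_i clamp (x0 0 i) r (x 0 i).
have clr x : `|cl x - x0| <= r.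
  by apply: norm_le_coord => // i j; rewrite ord1 !mxE clamp_near.
have clid x : `|x - x0| <= r -> cl x = x.
  move=> xr; apply/rowP => i; rewrite mxE clamp_id //; apply: le_trans xr.
  by have := coord_le_norm (x - x0) 0 i; rewrite !mxE.
have clL x y : `|cl x - cl y| <= `|x - y|.
  apply: norm_le_coord => // i j; rewrite ord1 !mxE.
  apply: le_trans (clamp_lipschitz _ _ _ r0') _.
  by have := coord_le_norm (x - y) 0 j; rewrite !mxE.
have [|T [u [T0 u0 du]]] := @picard_global n (F \o cl) x0 L L0.
  by move=> x y; apply: le_trans (FL _ _ (clr _) (clr _)) _; rewrite ler_pM2l.
have d0 : is_derive (0 : R) (1 : R) u (F (cl (u 0))) by apply: du; rewrite normr0.
have /cvgrPdist_le/(_ r r0)[e /= e0 eP] := is_derive1_continuous d0.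
exists (Num.min T e), u; split=> //; first by rewrite lt_min T0.
move=> t; rewrite lt_min => /andP[tT te].
have ur : `|u t - x0| <= r.
  by rewrite distrC -u0; apply: eP; rewrite /= sub0r normrN.
by split=> //; have := du t tT; rewrite /= clid.
Qed.

End ODE.

(** * Maps of class C^k on open sets *)

Section Smooth.
Context {R : realType}.
Implicit Types V W : normedModType R.

Lemma near_eq_continuous V W (f g : V -> W) x :
  (\near x, f x = g x) -> {for x, continuous f} -> {for x, continuous g}.
Proof.
move=> fg cf; have fgx : f x = g x by exact: nbhs_singleton fg.
rewrite /prop_for /continuous_at -fgx; apply: cvg_trans cf; apply: near_eq_cvg.
by near=> y; rewrite (near fg y).
Unshelve. all: by end_near. Qed.

Lemma near_eq_differentiable V W (f g : V -> W) x :
  (\near x, f x = g x) -> differentiable f x -> differentiable g x.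
Proof.
move=> fg /diff_locallyP[cd fE].
have gE : g \o shift x = cst (g x) + 'd f x +o_ 0 id.
  apply/eqaddoP => _/posnumP[e].
  move/eqaddoP: fE => /(_ e%:num (ltac:(by []))) H.
  have fgx : f x = g x by exact: nbhs_singleton fg.
  move: H; apply: filter_app.
  have : \forall y \near (0 : V), f (y + x) = g (y + x).
    have /nbhs_ballP[d d0 dP] := fg; apply/nbhs_ballP; exists d => // y.
    rewrite -ball_normE /= sub0r normrN => yd; apply: dP.
    by rewrite -ball_normE /= opprD addrCA subrr addr0 normrN.
  apply: filterS => y fgy.
  by rewrite -![(_ + _ : V -> W) _]/(_ + _) -![(- _ : V -> W) _]/(- _) /= -fgy -fgx.
apply/diff_locallyP; have -> : 'd g x = 'd f x :> (V -> W) by exact: diff_unique.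
by split.
Unshelve. all: by end_near. Qed.

Lemma near_eq_on_open V W (U : set V) (f g : V -> W) x : open U ->
  (forall y, U y -> f y = g y) -> U x -> \near x, f x = g x.
Proof.
move=> oU fg Ux; near=> y; apply: fg; near: y.
exact: open_nbhs_nbhs.
Unshelve. all: by end_near. Qed.

(** Rules of differentiation hold only on [U], whereas [diff_times] speaks of the
    total function ['D_v f]; hence this congruence. *)
Lemma diff_times_ext V W k (U : set V) (f g : V -> W) : open U ->
  (forall y, U y -> f y = g y) -> diff_times k U f -> diff_times k U g.
Proof.
move=> oU; elim: k f g => [|k IH] f g fg /=.
  by move=> cf x Ux; apply: near_eq_continuous (cf x Ux); exact: near_eq_on_open fg Ux.
move=> [df Df]; split.
  by move=> x Ux; apply: near_eq_differentiable (df x Ux); exact: near_eq_on_open fg Ux.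
move=> v; apply: (IH ('D_v f)); last exact: Df.
by move=> y Uy; apply: near_eq_derive; exact: near_eq_on_open fg Uy.
Qed.

Lemma diff_times_sub V W k (U U' : set V) (f : V -> W) : U' `<=` U ->
  diff_times k U f -> diff_times k U' f.
Proof.
move=> UU'; elim: k f => [|k IH] f /=; first by move=> cf x /UU'; exact: cf.
by move=> [df Df]; split=> [x /UU'|v]; [exact: df|exact: IH].
Qed.

Lemma diff_timesW V W k (U : set V) (f : V -> W) :
  diff_times k.+1 U f -> diff_times k U f.
Proof.
elim: k f => [|k IH] f /= [df Df]; first by move=> x Ux; exact: differentiable_continuous (df x Ux).
by split=> // v; apply: IH.
Qed.

Lemma diff_times_cst V W k (U : set V) (a : W) : diff_times k U (fun _ : V => a).
Proof.
elim: k a => [|k IH] a /=; first by move=> x _; exact: cst_continuous.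
split=> [x _|v]; first exact: differentiable_cst.
rewrite (_ : 'D_v _ = fun=> 0); first exact: IH.
by apply/funext => x; exact: derive_cst.
Qed.

Lemma diff_times_coord k n (U : set 'rV[R]_n) i :
  diff_times k U (fun x : 'rV[R]_n => x 0 i).
Proof.
case: k => [|k] /=; first by move=> x _; exact: coord_continuous.
split=> [x _|v]; first exact: differentiable_coord.
rewrite (_ : 'D_v _ = fun=> v 0 i); first exact: diff_times_cst.
apply/funext => x.
by have /is_derive_rowP/(_ i)[_] := @is_derive_id R 'rV[R]_n x v.
Qed.

Lemma diff_times_add V W k (U : set V) (f g : V -> W) : open U ->
  diff_times k U f -> diff_times k U g -> diff_times k U (fun x => f x + g x).
Proof.
move=> oU; elim: k f g => [|k IH] f g /=.
  by move=> cf cg x Ux; apply: continuousD; [exact: cf|exact: cg].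
move=> [df Df] [dg Dg]; split.
  by move=> x Ux; apply: differentiableD; [exact: df|exact: dg].
move=> v; apply: (@diff_times_ext _ _ _ _ (fun x => 'D_v f x + 'D_v g x)) => //.
  by move=> y Uy; rewrite deriveD //; apply: diff_derivable; [exact: df|exact: dg].
by apply: IH.
Qed.

Lemma diff_times_mul V k (U : set V) (f g : V -> R) : open U ->
  diff_times k U f -> diff_times k U g -> diff_times k U (fun x => f x * g x).
Proof.
move=> oU; elim: k f g => [|k IH] f g.
  by move=> cf cg x Ux; apply: continuousM; [exact: cf|exact: cg].
move=> df' dg'; have [df Df] := df'; have [dg Dg] := dg'; split.
  by move=> x Ux; apply: differentiableM; [exact: df|exact: dg].
move=> v; apply: (@diff_times_ext _ _ _ _ (fun x => f x * 'D_v g x + g x * 'D_v f x)) => //.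
  by move=> y Uy; rewrite deriveM //; apply: diff_derivable; [exact: df|exact: dg].
apply: diff_times_add => //; apply: IH.
- exact: diff_timesW df'.
- exact: Dg.
- exact: diff_timesW dg'.
- exact: Df.
Qed.

Lemma diff_times_inv V k (U : set V) (f : V -> R) : open U ->
  (forall x, U x -> f x != 0) ->
  diff_times k U f -> diff_times k U (fun x => (f x)^-1).
Proof.
move=> oU f0; elim: k f f0 => [|k IH] f f0.
  by move=> cf x Ux; apply: continuousV; [exact: f0|exact: cf].
move=> df'; have [df Df] := df'; split.
  by move=> x Ux; apply: differentiableV; [exact: df|exact: f0].
move=> v; apply: (@diff_times_ext _ _ _ _ (fun x => (-1 * ((f x)^-1 * (f x)^-1)) * 'D_v f x)) => //.
  move=> y Uy; rewrite deriveV; [|exact: f0|exact: diff_derivable (df _ Uy)].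
  by rewrite -[_ *: _]/(_ * _) mulN1r -exprVn expr2.
apply: diff_times_mul => //.
  apply: diff_times_mul => //; first exact: diff_times_cst.
  by apply: diff_times_mul => //; apply: IH => //; exact: diff_timesW df'.
exact: Df.
Qed.

Lemma diff_times_sum V k (U : set V) (I : Type) (r : seq I) (P : pred I)
    (F : I -> V -> R) : open U ->
  (forall i, diff_times k U (F i)) -> diff_times k U (fun x => \sum_(i <- r | P i) F i x).
Proof.
move=> oU HF; elim: r => [|i r IH].
  by under [X in diff_times _ _ X]eq_fun do rewrite big_nil; exact: diff_times_cst.
under [X in diff_times _ _ X]eq_fun do rewrite big_cons.
by case: (P i) => //; exact: diff_times_add.
Qed.

Lemma diff_times_prod V k (U : set V) (I : Type) (r : seq I) (P : pred I)
    (F : I -> V -> R) : open U ->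
  (forall i, diff_times k U (F i)) -> diff_times k U (fun x => \prod_(i <- r | P i) F i x).
Proof.
move=> oU HF; elim: r => [|i r IH].
  by under [X in diff_times _ _ X]eq_fun do rewrite big_nil; exact: diff_times_cst.
under [X in diff_times _ _ X]eq_fun do rewrite big_cons.
by case: (P i) => //; exact: diff_times_mul.
Qed.

Lemma diff_times_entry V k (U : set V) m n (f : V -> 'M[R]_(m, n)) i j :
  open U ->
  diff_times k U f -> diff_times k U (fun x => f x i j).
Proof.
move=> oU; elim: k f => [|k IH] f /=.
  move=> cf x Ux.
  exact: (@continuous_comp _ _ _ f (fun A : 'M[R]_(m, n) => A i j) x (cf x Ux)
    (@coord_continuous R m n i j (f x))).
move=> [df Df]; split.
  move=> x Ux; apply: (@differentiable_comp _ _ _ _ f (fun A : 'M[R]_(m, n) => A i j)).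
    exact: df.
  exact: differentiable_coord.
move=> v; apply: (@diff_times_ext _ _ _ _ (fun x => ('D_v f) x i j)) => //.
  by move=> y Uy; rewrite derive_mx ?mxE //; apply: diff_derivable; exact: df.
exact: IH.
Qed.

Lemma differentiable_row V n (f : V -> 'rV[R]_n) x :
  (forall i, differentiable (fun y => f y 0 i) x) -> differentiable f x.
Proof.
move=> df; have -> : f = \sum_i (fun y => f y 0 i *: delta_mx 0 i).
  apply/funext => y; rewrite fct_sumE; exact: row_sum_delta.
by apply: differentiable_sum => i; apply: differentiableZl.
Qed.

Lemma diff_times_row V k (U : set V) n (f : V -> 'rV[R]_n) : open U ->
  (forall i, diff_times k U (fun x => f x 0 i)) -> diff_times k U f.
Proof.
move=> oU; elim: k f => [|k IH] f /=.
  by move=> cf x Ux; apply: continuous_rowP => i; exact: cf.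
move=> H; have df x : U x -> differentiable f x.
  by move=> Ux; apply: differentiable_row => i; have [+ _] := H i; apply.
split=> // v; apply: IH => i; have [_ /(_ v)] := H i.
apply: diff_times_ext => // y Uy.
by rewrite derive_mx ?mxE //; apply: diff_derivable; exact: df.
Qed.

Lemma derive_partials n W (g : 'rV[R]_n -> W) x v : differentiable g x ->
  'D_v g x = \sum_i v 0 i *: partial i g x.
Proof.
move=> dg; rewrite deriveE // {1}(row_sum_delta v) linear_sum.
by apply: eq_bigr => i _; rewrite linearZ /= /partial deriveE.
Qed.

(** By the chain rule a directional derivative of the composite is a sum of products
    in which [g] has lost one derivative, so induction on [k] applies. *)
Lemma diff_times_comp V n k (U : set V) (U' : set 'rV[R]_n) (f : V -> 'rV[R]_n)
    (g : 'rV[R]_n -> R) : open U -> (forall x, U x -> U' (f x)) ->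
  diff_times k U f -> diff_times k U' g -> diff_times k U (fun x => g (f x)).
Proof.
move=> oU fU; elim: k g => [|k IH] g.
  by move=> cf cg x Ux; apply: continuous_comp; [exact: cf|exact/cg/fU].
move=> df' [dg Dg]; have [df Df] := df'; split.
  by move=> x Ux; apply: (@differentiable_comp _ _ _ _ f g); [exact: df|exact/dg/fU].
move=> v; apply: (@diff_times_ext _ _ _ _
  (fun x => \sum_i ('D_v f) x 0 i * partial i g (f x))) => //.
  move=> y Uy; rewrite -(@derive_partials _ R); last exact/dg/fU.
  have dfy := df y Uy; have dgy := dg _ (fU _ Uy).
  rewrite !deriveE //; last exact: (@differentiable_comp _ _ _ _ f g).
  by have /= := congr1 (fun L : V -> R => L v) (diff_comp dfy dgy).
apply: diff_times_sum => // i; apply: diff_times_mul => //.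
  by apply: (diff_times_entry (f := 'D_v f)) => //; exact: Df.
by apply: IH; [exact: diff_timesW df'|exact: Dg].
Qed.

Lemma diff_times_comp_row V n m k (U : set V) (U' : set 'rV[R]_n) (f : V -> 'rV[R]_n)
    (g : 'rV[R]_n -> 'rV[R]_m) : open U -> open U' -> (forall x, U x -> U' (f x)) ->
  diff_times k U f -> diff_times k U' g -> diff_times k U (fun x => g (f x)).
Proof.
move=> oU oU' fU df dg; apply: diff_times_row => // i.
apply: (diff_times_comp (U' := U') (g := fun y => g y 0 i)) => //.
exact: diff_times_entry.
Qed.

Lemma diff_times_det V k (U : set V) n (f : V -> 'M[R]_n) : open U ->
  (forall i j, diff_times k U (fun x => f x i j)) ->
  diff_times k U (fun x => \det (f x)).
Proof.
move=> oU df; apply: diff_times_sum => // s; apply: diff_times_mul => //.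
  exact: diff_times_cst.
exact: diff_times_prod.
Qed.

(** By Cramer's rule. *)
Lemma diff_times_invmx V k (U : set V) n (f : V -> 'M[R]_n) i j : open U ->
  (forall x, U x -> f x \in unitmx) ->
  (forall i j, diff_times k U (fun x => f x i j)) ->
  diff_times k U (fun x => invmx (f x) i j).
Proof.
move=> oU uf df.
apply: (@diff_times_ext _ _ _ _ (fun x => (\det (f x))^-1 * cofactor (f x) j i)) => //.
  by move=> y Uy; rewrite /invmx uf // !mxE.
apply: diff_times_mul => //.
  apply: diff_times_inv => //; last exact: diff_times_det.
  by move=> x /uf; rewrite unitmxE unitfE.
apply: diff_times_mul => //; first exact: diff_times_cst.
apply: diff_times_det => // a b.
by under [X in diff_times _ _ X]eq_fun do rewrite !mxE; exact: df.
Qed.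

Lemma is_derive_line V W (f : V -> W) (y w : V) t df :
  is_derive (y + t *: w) w f df -> is_derive t (1 : R) (fun s => f (y + s *: w)) df.
Proof.
move=> [d1 d2].
have E : (fun h : R => h^-1 *: (((fun s => f (y + s *: w)) \o shift t) (h *: (1 : R))
    - f (y + t *: w))) =
  (fun h => h^-1 *: ((f \o shift (y + t *: w)) (h *: w) - f (y + t *: w))).
  apply/funext => h /=; congr (_ *: (f _ - _)).
  by rewrite [h *: _]mulr1 scalerDl addrCA.
by apply: DeriveDef; [rewrite /derivable E|rewrite /derive E].
Qed.

(** Near [x0] the partial derivatives are bounded, and the mean value theorem applies
    on segments. *)
Lemma C1_lipschitz n m (U : set 'rV[R]_n) (f : 'rV[R]_n -> 'rV[R]_m) x0 :
  open U -> U x0 -> diff_times 1 U f ->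
  exists r L, [/\ 0 < r, 0 < L, (forall x, `|x - x0| <= r -> U x) &
    forall x y, `|x - x0| <= r -> `|y - x0| <= r -> `|f x - f y| <= L * `|x - y|].
Proof.
move=> oU Ux0 [df Df].
pose M := \sum_i (`|partial i f x0| + 1).
have H1 : nbhs x0 U by exact: open_nbhs_nbhs.
have H2 : nbhs x0 [set y | forall i, `|partial i f y| <= `|partial i f x0| + 1].
  apply: (@filter_forall _ _
    (fun i y => `|partial i f y| <= `|partial i f x0| + 1) _ (nbhs_filter x0)) => i.
  have /cvgrPdist_le/(_ 1 ltr01) := Df (delta_mx 0 i) _ Ux0.
  apply: filterS => y Hy; rewrite -[partial i f y](subKr (partial i f x0)).
  by apply: le_trans (ler_normB _ _) _; rewrite lerD2l.
have H12 : nbhs x0 (U `&` [set y | forall i, `|partial i f y| <= `|partial i f x0| + 1]).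
  exact: filterI H1 H2.
have /nbhs_ballP[e /= e0 eP] := H12.
have e2 x : `|x - x0| <= e / 2 -> ball x0 e x.
  by rewrite -ball_normE /= distrC; lra.
exists (e / 2), (M + 1); split; [by lra| | |].
- by rewrite ltr_wpDl // sumr_ge0 // => i _; rewrite addr_ge0.
- by move=> x /e2/eP[].
move=> x y xr yr.
pose w := x - y.
have seg s : 0 <= s <= 1 -> `|y + s *: w - x0| <= e / 2.
  move=> /andP[s0 s1].
  rewrite (_ : _ - x0 = (1 - s) *: (y - x0) + s *: (x - x0)); last first.
    by apply/rowP => i; rewrite !mxE; ring.
  apply: le_trans (ler_normD _ _) _; rewrite !normrZ !ger0_norm ?subr_ge0 //.
  have : 0 <= 1 - s by lra.
  by nra.
have := @mvt_norm R m (fun s => f (y + s *: w)) (fun s => 'D_w f (y + s *: w)) 0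
  ((M + 1) * `|x - y|) 1 0.
rewrite scaler0 !subr0 scale1r scale0r addr0 normr1 mulr1 /w subrKC; apply.
move=> s; rewrite (min_idPr ler01) (max_idPl ler01) => s01.
have [Us dfs] := eP _ (e2 _ (seg s s01)).
have dd := df _ Us.
split; first by apply: is_derive_line; apply: derivableP; exact: diff_derivable.
rewrite subr0 derive_partials //.
apply: le_trans (ler_norm_sum _ _ _) _.
rewrite -/w; apply: le_trans (_ : M * `|w| <= _); last by rewrite ler_wpM2r // lerDl.
rewrite mulr_suml; apply: ler_sum => i _; rewrite normrZ mulrC ler_pM //.
exact: coord_le_norm.
Qed.

End Smooth.

(** * Metrics whose geodesics are straight *)

Section Beltrami.
Context {R : realType}.

Lemma quadE n (A : 'M[R]_n) y : quad A y = (y *m A *m y^T) 0 0.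
Proof.
rewrite /quad mxE exchange_big; apply: eq_bigr => j _.
rewrite !mxE mulr_suml; apply: eq_bigr => i _.
by rewrite [y 0 i * _]mulrC.
Qed.

Lemma posdef_unitmx n (A : 'M[R]_n) :
  (forall y, y != 0 -> 0 < quad A y) -> A \in unitmx.
Proof.
move=> pA; rewrite -row_free_unit -kermx_eq0; apply/eqP/row_matrixP => i.
rewrite row0; apply/eqP; apply: contraT => /pA.
by rewrite quadE -row_mul mulmx_ker row0 mul0mx mxE ltxx.
Qed.

Lemma is_derive_unique (V W : normedModType R) (f : V -> W) x v a b :
  is_derive x v f a -> is_derive x v f b -> a = b.
Proof. by move=> [_ <-] [_ <-]. Qed.

Lemma near_cst_is_derive (V W : normedModType R) (f : V -> W) x v a c :
  (\near x, f x = c) -> is_derive x v f a -> a = 0.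
Proof.
move=> fc fa; apply: (is_derive_unique _ (is_derive_cst c x v)).
exact: near_eq_is_derive fc fa.
Qed.

(** [christoffel h phi] unfolds to [chris (h phi)]. *)
Definition chris n (H : 'rV[R]_n -> 'M[R]_n) x (k i j : 'I_n) : R :=
  2^-1 * \sum_l invmx (H x) k l *
    (partial i (fun z => H z j l) x + partial j (fun z => H z i l) x
     - partial l (fun z => H z i j) x).

(** The geodesic equation is a first-order system for position and velocity, stored
    as the two halves of one row vector. *)
Lemma geodesic_exists n (H : 'rV[R]_n -> 'M[R]_n) (U : set 'rV[R]_n) x0 y0 :
  open U -> smooth_on U H -> (forall x, U x -> H x \in unitmx) -> U x0 ->
  exists (T : R) (g w : R -> 'rV[R]_n), [/\ 0 < T, g 0 = x0, w 0 = y0 &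
    forall t : R, `|t| < T -> [/\ U (g t), is_derive t (1 : R) g (w t) &
      is_derive t (1 : R) w
        (\row_k - \sum_i \sum_j chris H (g t) k i j * w t 0 i * w t 0 j)]].
Proof.
move=> oU sH uH Ux0.
pose F (z : 'rV[R]_(n + n)) : 'rV[R]_(n + n) :=
  row_mx (rsubmx z) (\row_k - \sum_i \sum_j
    chris H (lsubmx z) k i j * (rsubmx z) 0 i * (rsubmx z) 0 j).
pose U' := [set z : 'rV[R]_(n + n) | U (lsubmx z)].
have cl : continuous (fun z : 'rV[R]_(n + n) => lsubmx z).
  by move=> z; apply: differentiable_continuous; exact: differentiable_lsubmx.
have oU' : open U' by apply: open_comp => // z _; exact: cl.
have U'x : U' (row_mx x0 y0) by rewrite /U' /= row_mxKl.
have sHe k i j : diff_times k U (fun x => H x i j) by apply: diff_times_entry.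
have sHp k l i j : diff_times k U (partial l (fun x => H x i j)).
  by have [_] := sHe k.+1 i j; apply.
have sc k a i j : diff_times k U (fun x => chris H x a i j).
  apply: diff_times_mul => //; first exact: diff_times_cst.
  apply: diff_times_sum => // l; apply: diff_times_mul => //.
    exact: diff_times_invmx.
  apply: diff_times_add => //; first exact: diff_times_add.
  apply: (@diff_times_ext _ _ _ _ _ (fun x => -1 * partial l (fun z => H z i j) x)) => //.
    by move=> y _; rewrite mulN1r.
  by apply: diff_times_mul => //; exact: diff_times_cst.
have sF : diff_times 1 U' F.
  apply: diff_times_row => // i.
  have [j ->|j ->] := split_ordP i.
    under [X in diff_times _ _ X]eq_fun do rewrite row_mxEl mxE.
    exact: diff_times_coord.
  under [X in diff_times _ _ X]eq_fun do rewrite row_mxEr mxE.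
  apply: (@diff_times_ext _ _ _ _ _ (fun z : 'rV[R]_(n + n) => -1 * \sum_i0 \sum_j0
    chris H (lsubmx z) j i0 j0 * z 0 (rshift n i0) * z 0 (rshift n j0))) => //.
    move=> z _; rewrite mulN1r; congr (- _).
    by apply: eq_bigr => a _; apply: eq_bigr => b _; rewrite !mxE.
  apply: diff_times_mul => //; first exact: diff_times_cst.
  apply: diff_times_sum => // a; apply: diff_times_sum => // b.
  apply: diff_times_mul => //; last exact: diff_times_coord.
  apply: diff_times_mul => //; last exact: diff_times_coord.
  apply: (@diff_times_comp _ _ _ _ _ U (fun z : 'rV[R]_(n + n) => lsubmx z)
    (fun x => chris H x j a b)) => //.
  apply: diff_times_row => // c.
  by under [X in diff_times _ _ X]eq_fun do rewrite mxE; exact: diff_times_coord.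
have [r [L [r0 L0 rU FL]]] := C1_lipschitz oU' U'x sF.
have [T [u [T0 u0 du]]] := picard r0 L0 FL.
exists T, (fun t => lsubmx (u t)), (fun t => rsubmx (u t)).
rewrite u0 row_mxKl row_mxKr; split=> // t tT.
have [ur dut] := du t tT; split; first exact: rU.
  apply/is_derive_rowP => i.
  have := (is_derive_rowP _ _ _ _).1 dut (lshift n i); rewrite row_mxEl.
  by under [X in is_derive _ _ X]eq_fun do rewrite -[u _]hsubmxK row_mxEl.
apply/is_derive_rowP => i.
have := (is_derive_rowP _ _ _ _).1 dut (rshift n i); rewrite row_mxEr.
by under [X in is_derive _ _ X]eq_fun do rewrite -[u _]hsubmxK row_mxEr.
Qed.

(** Velocity and acceleration of a straight curve both lie in the direction of
    the line, hence are parallel. *)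
Lemma straight_acceleration n (g w : R -> 'rV[R]_n) (T : R) a i j : 0 < T ->
  straight (g @` [set t : R | `|t| < T]) ->
  (forall t : R, `|t| < T -> is_derive t (1 : R) g (w t)) ->
  is_derive (0 : R) (1 : R) w a ->
  w 0 0 i * a 0 j = w 0 0 j * a 0 i.
Proof.
move=> T0 [p [v [J _ gE]]] dg dw.
have gv t : `|t| < T -> exists s, g t = p + s *: v.
  move=> tT; have : (g @` [set t | `|t| < T]) (g t) by exists t.
  by rewrite gE => -[s _ <-]; exists s.
have nearT (t : R) : `|t| < T -> \forall s \near t, `|s| < T.
  by move=> tT; have /cvgr_lt := @norm_continuous _ _ t; exact.
have dcoord (f : R -> 'rV[R]_n) t b k l : is_derive t (1 : R) f b ->
    is_derive t (1 : R) (fun s => v 0 k * f s 0 l - v 0 l * f s 0 k)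
      (v 0 k * b 0 l - v 0 l * b 0 k).
  by move=> /is_derive_rowP df; apply: is_deriveB; apply: is_deriveZ.
(* [v_k g_l - v_l g_k] is constant on the line, so its first two derivatives
   vanish. *)
have wv t k l : `|t| < T -> v 0 k * w t 0 l - v 0 l * w t 0 k = 0.
  move=> tT; apply: (near_cst_is_derive (c := v 0 k * p 0 l - v 0 l * p 0 k) _
    (dcoord _ _ _ _ _ (dg t tT))).
  apply: filterS (nearT t tT) => s sT.
  by have [c ->] := gv s sT; rewrite !mxE; ring.
have T00 : `|0 : R| < T by rewrite normr0.
have av k l : v 0 k * a 0 l - v 0 l * a 0 k = 0.
  apply: (near_cst_is_derive (c := 0) _ (dcoord _ _ _ _ _ dw)).
  apply: filterS (nearT 0 T00) => s sT.
  exact: wv.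
have [v0|/rV0Pn[k vk]] := eqVneq v 0.
  have -> : w 0 = 0; last by rewrite !mxE !mul0r.
  apply: (near_cst_is_derive (c := p) _ (dg 0 T00)).
  apply: filterS (nearT 0 T00) => s sT.
  by have [c ->] := gv s sT; rewrite v0 scaler0 addr0.
have par (b : 'rV[R]_n) : (forall l, v 0 k * b 0 l - v 0 l * b 0 k = 0) ->
    forall l, b 0 l = v 0 l * (b 0 k / v 0 k).
  by move=> H l; apply: (mulfI vk); move: (H l) => /eqP; rewrite subr_eq0 => /eqP ->; field.
have wl l := par (w 0) (fun l => wv 0 k l T00) l.
by rewrite wl [w 0 0 j]wl (par a (av k) i) (par a (av k) j); ring.
Qed.

(** A quadratic map with values parallel to the argument is a linear form times the
    argument; its values at the [e_a + t e_b] with [t = 1, -1] determine it. *)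
Lemma projective_symbols n (G : 'I_n -> 'I_n -> 'I_n -> R) :
  (forall k i j, G k i j = G k j i) ->
  (forall (y : 'rV[R]_n) k l,
     y 0 k * (\sum_i \sum_j G l i j * y 0 i * y 0 j) =
     y 0 l * (\sum_i \sum_j G k i j * y 0 i * y 0 j)) ->
  forall k a b, G k a b = (k == a)%:R * (G b b b / 2) + (k == b)%:R * (G a a a / 2).
Proof.
move=> Gs GP.
have sd (f : 'I_n -> R) a : \sum_i f i * (delta_mx 0 a : 'rV[R]_n) 0 i = f a.
  rewrite (bigD1 a) //= mxE !eqxx mulr1 big1 ?addr0 // => i ia.
  by rewrite mxE (negbTE ia) andbF mulr0.
have Qe k a b t : let y : 'rV[R]_n := delta_mx 0 a + t *: delta_mx 0 b in
    \sum_i \sum_j G k i j * y 0 i * y 0 j = G k a a + 2 * t * G k a b + t ^+ 2 * G k b b.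
  move=> y.
  have lin (f : 'I_n -> R) : \sum_i f i * y 0 i = f a + t * f b.
    have yE i : y 0 i = (delta_mx 0 a : 'rV[R]_n) 0 i + t * (delta_mx 0 b : 'rV[R]_n) 0 i.
      by rewrite /y [LHS]mxE [X in _ + X]mxE.
    under eq_bigr do rewrite yE mulrDr mulrCA.
    by rewrite big_split /= -mulr_sumr !sd.
  under eq_bigr => i _ do rewrite (lin (fun j => G k i j * y 0 i)) mulrA -mulrDl.
  by rewrite (lin (fun i => G k i a + t * G k i b)) [G k b a]Gs; ring.
move=> k a b.
have [->{b}|ab] := eqVneq b a.
  have := GP (delta_mx 0 a + 0 *: delta_mx 0 a) a k.
  rewrite !Qe !mxE !eqxx /=.
  have [->|ka] := eqVneq k a; first by move=> _ /=; field.
  move=> /= h; have -> : G k a a = 0 by lra.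
  by rewrite !mul0r addr0.
have E t l m := GP (delta_mx 0 a + t *: delta_mx 0 b) l m.
have val t l : (delta_mx 0 a + t *: delta_mx 0 b : 'rV[R]_n) 0 l = (l == a)%:R + t * (l == b)%:R.
  by rewrite !mxE !eqxx.
have sq c d : c != d -> G d c c = 0.
  move=> cd; have := GP (delta_mx 0 c + 0 *: delta_mx 0 c) c d.
  by rewrite !Qe !mxE !eqxx /= [d == c]eq_sym (negbTE cd) /=; lra.
have E1 := E 1 a b; have E2 := E (-1) a b.
rewrite !val !Qe !eqxx (eq_sym a b) (negbTE ab) (sq _ _ ab) /= in E1 E2.
rewrite eq_sym in ab; rewrite (sq _ _ ab) in E1 E2.
have [->|ka] := eqVneq k a.
  by rewrite (negbTE ab) mul0r mul1r addr0; lra.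
have [->|kb] := eqVneq k b.
  by rewrite mul0r mul1r add0r; lra.
have := E 1 a k; rewrite !val !Qe !eqxx (negbTE ka) (negbTE kb) (negbTE ab) /=.
rewrite (sq a k) 1?eq_sym // (sq b k) 1?eq_sym //.
by rewrite !mul0r; lra.
Qed.

(** The symbols with a lowered index are the usual combination of derivatives of
    the metric; adding two of them isolates one derivative. *)
Lemma projective_metric_derivative n (H : 'rV[R]_n -> 'M[R]_n) (U : set 'rV[R]_n)
    x (psi : 'I_n -> R) :
  open U -> U x -> (forall y, U y -> (H y)^T = H y) -> H x \in unitmx ->
  (forall k a b, chris H x k a b = (k == a)%:R * psi b + (k == b)%:R * psi a) ->
  forall k i j, partial k (fun z => H z i j) x =
    2 * psi k * H x i j + psi i * H x k j + psi j * H x i k.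
Proof.
move=> oU Ux symH uH ch.
pose D k i j := partial k (fun z => H z i j) x.
have Ds k i j : D k i j = D k j i.
  apply: near_eq_derive; apply: (near_eq_on_open oU) => // y Uy.
  by rewrite -[in RHS](symH y Uy) mxE.
have Hs i j : H x i j = H x j i by rewrite -[in LHS](symH x Ux) mxE.
have low m i j : 2^-1 * (D i j m + D j i m - D m i j) = H x m i * psi j + H x m j * psi i.
  have : \sum_k H x m k * chris H x k i j =
      2^-1 * (D i j m + D j i m - D m i j).
    under eq_bigr => k _ do rewrite /chris mulrCA mulr_sumr.
    rewrite -mulr_sumr exchange_big /=; congr (_ * _).
    under eq_bigr => l _ do (under eq_bigr => k _ do rewrite mulrA; rewrite -mulr_suml).
    rewrite (bigD1 m) //= [X in _ + X]big1 ?addr0.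
      have := mulmxV uH => /matrixP/(_ m m); rewrite !mxE eqxx /= => ->.
      by rewrite mul1r.
    move=> l lm; have := mulmxV uH => /matrixP/(_ m l).
    by rewrite !mxE eq_sym (negbTE lm) /= => ->; rewrite mul0r.
  move=> <-; under eq_bigr => k _ do rewrite ch mulrDr.
  rewrite big_split /=; congr (_ + _).
    rewrite (bigD1 i) //= eqxx mul1r big1 ?addr0 // => k ki.
    by rewrite (negbTE ki) mul0r mulr0.
  rewrite (bigD1 j) //= eqxx mul1r big1 ?addr0 // => k ki.
  by rewrite (negbTE ki) mul0r mulr0.
move=> k i j; rewrite -/(D k i j).
have h1 := low i k j; have h2 := low j k i.
rewrite (Ds k j i) in h1; rewrite (Ds i k j) in h2.
rewrite (Hs j k) (Hs j i) in h2.
have := Ds j k i; have := Ds i k j; have := Hs i k; have := Hs k j.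
move=> e1 e2 e3 e4; rewrite (Hs k j); rewrite e1 in h2.
lra.
Qed.

End Beltrami.

(** * Determinants and positive definite matrices *)

Section LinearAlgebra.

(** Both sides are the determinant of the block matrix with diagonal blocks 1 and
    off-diagonal blocks [- v] and [u^T], eliminated in the two possible orders. *)
Lemma det_add_rank1 (F : fieldType) n (u v : 'rV[F]_n) :
  \det (1%:M + u^T *m v) = 1 + (v *m u^T) 0 0.
Proof.
pose B := block_mx (1%:M : 'M[F]_1) (- v) (u^T) (1%:M : 'M[F]_n).
have e1 : block_mx 1%:M 0 u^T 1%:M *m block_mx 1%:M (- v) 0 (1%:M + u^T *m v) = B.
  rewrite mulmx_block !mul1mx !mul0mx !mulmx1 !addr0.
  by rewrite mulmxN addrCA addNr addr0.
have e2 : block_mx (1%:M + v *m u^T) (- v) 0 1%:M *m block_mx 1%:M 0 u^T 1%:M = B.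
  by rewrite mulmx_block !mul0mx !mulmx1 !mulmx0 !mul1mx !add0r mulNmx addrK.
have d1 : \det B = \det (1%:M + u^T *m v).
  by rewrite -e1 det_mulmx det_lblock det_ublock !det1 !mul1r.
rewrite -d1 -e2 det_mulmx det_lblock det_ublock !det1 !mulr1.
by rewrite det_mx11 !mxE.
Qed.

Context {R : realType}.

(** Cholesky elimination: the Schur complement [D'] of the corner entry is again
    positive definite, and induction applies to it. *)
Lemma posdef_orthonormal n (A : 'M[R]_n) : A^T = A ->
  (forall y, y != 0 -> 0 < quad A y) ->
  exists2 C : 'M[R]_n, C \in unitmx & C *m A *m C^T = 1%:M.
Proof.
elim: n A => [|n IH] A symA pA.
  exists 1%:M; first exact: unitmx1.
  by apply/matrixP => -[].
rewrite -[n.+1]/(1 + n)%N in A symA pA *.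
pose b := ursubmx A; pose D := drsubmx A; pose al := ulsubmx A 0 0.
have AE : A = block_mx al%:M b b^T D.
  rewrite -[LHS]submxK; congr block_mx; first by rewrite [LHS]mx11_scalar.
  by rewrite /b trmx_ursub symA.
have DT : D^T = D by rewrite /D trmx_drsub symA.
have al0 : 0 < al.
  have := pA (row_mx 1%:M 0); rewrite quadE {1}AE mul_row_block !mul1mx !mul0mx !addr0.
  rewrite tr_row_mx mul_row_col trmx0 mulmx0 addr0 trmx1 mulmx1 !mxE eqxx; apply.
  by apply/eqP => /(congr1 (fun M => lsubmx M 0 0)); rewrite row_mxKl !mxE; apply/eqP/oner_neq0.
pose D' := D - al^-1 *: (b^T *m b).
have [||C Cu CD] := IH D'.
- by rewrite /D' linearB linearZ /= trmx_mul trmxK DT.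
- move=> y y0; have := pA (row_mx (- al^-1 *: (y *m b^T)) y).
  rewrite quadE {1}AE mul_row_block tr_row_mx mul_row_col.
  rewrite mul_mx_scalar scalerA mulrN mulfV ?gt_eqF // scaleN1r addNr mul0mx add0r.
  rewrite (_ : _ *m b + y *m D = y *m D') -?quadE; last first.
    by rewrite /D' mulmxBr -scalemxAr mulmxA -scalemxAl scaleNr addrC.
  apply; apply: contra_neq y0 => /(congr1 rsubmx); rewrite row_mxKr => ->.
  exact: linear0.
pose L := block_mx ((Num.sqrt al)^-1%:M : 'M[R]_1) 0 (- al^-1 *: b^T) (1%:M : 'M[R]_n).
exists (block_mx 1%:M 0 0 C *m L).
  rewrite unitmxE det_mulmx !det_lblock !det1 mul1r mulr1 det_scalar1 unitrM.
  by rewrite -unitmxE Cu unitfE invr_eq0 sqrtr_eq0 -ltNge al0.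
have LA : L *m A *m L^T = block_mx 1%:M 0 0 D'.
  have LA1 : L *m A = block_mx (Num.sqrt al)%:M ((Num.sqrt al)^-1 *: b) 0 D'.
    rewrite {1}AE /L mulmx_block !mul0mx !mul1mx !addr0 mul_scalar_mx scale_scalar_mx.
    rewrite mul_mx_scalar scalerA mulrN mulfV ?gt_eqF // scaleN1r addNr mul_scalar_mx.
    rewrite -scalemxAl scaleNr [- _ + _]addrC -/D'.
    by rewrite -{2}(sqr_sqrtr (ltW al0)) expr2 mulrA mulVf ?mul1r // sqrtr_eq0 -ltNge.
  rewrite LA1 /L tr_block_mx mulmx_block !tr_scalar_mx !trmx0 !mulmx0 !mul0mx.
  rewrite !mulmx1 !addr0 add0r linearZ /= trmxK mul_scalar_mx scale_scalar_mx.
  rewrite mulfV ?sqrtr_eq0 -?ltNge // mul_scalar_mx scalerA mulrN.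
  have -> : Num.sqrt al * al^-1 = (Num.sqrt al)^-1.
    rewrite -{2}(sqr_sqrtr (ltW al0)) expr2 invfM mulrA mulfV ?mul1r //.
    by rewrite sqrtr_eq0 -ltNge.
  by rewrite scaleNr addNr.
have -> : block_mx 1%:M 0 0 C *m L *m A *m (block_mx 1%:M 0 0 C *m L)^T =
    block_mx 1%:M 0 0 C *m (L *m A *m L^T) *m (block_mx 1%:M 0 0 C)^T.
  by rewrite trmx_mul !mulmxA.
rewrite LA tr_block_mx !mulmx_block !trmx0 !trmx1.
rewrite !mul1mx !mul0mx !mulmx0 !mulmx1 !addr0 !add0r mul0mx CD.
by rewrite -scalar_mx_block.
Qed.

Lemma is_derive_prod (V : normedModType R) (I : eqType) (r : seq I)
    (f : I -> V -> R) (f' : I -> R) x v : uniq r ->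
  (forall i, is_derive x v (f i) (f' i)) ->
  is_derive x v (fun z => \prod_(i <- r) f i z)
    (\sum_(i <- r) f' i * \prod_(j <- r | j != i) f j x).
Proof.
move=> + df; elim: r => [_|i r IH /andP[ir ur]].
  under [X in is_derive _ _ X]eq_fun do rewrite big_nil.
  by rewrite big_nil; exact: is_derive_cst.
under [X in is_derive _ _ X]eq_fun do rewrite big_cons.
rewrite big_cons big_cons eqxx /=.
have -> : \prod_(j <- r | j != i) f j x = \prod_(j <- r) f j x.
  rewrite [LHS]big_seq_cond [RHS]big_seq; apply: eq_bigl => j.
  by have [->|] := eqVneq j i; rewrite ?(negbTE ir) ?andbF ?andbT.
refine (is_derive_eq (is_deriveM (df i) (IH ur)) _).
rewrite addrC -[_ *: _]/(_ * _) [X in X + _]mulrC; congr (_ + _).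
rewrite -[_ *: _]/(_ * _) mulr_sumr [LHS]big_seq [RHS]big_seq.
apply: eq_bigr => j jr; rewrite big_cons.
by have [ji|_] := eqVneq i j; [rewrite ji jr in ir|rewrite mulrCA].
Qed.

(** Jacobi's formula: differentiate one row at a time and expand along that row. *)
Lemma is_derive_det (V : normedModType R) n (A : V -> 'M[R]_n) (A' : 'M[R]_n) x v :
  (forall i j, is_derive x v (fun z => A z i j) (A' i j)) ->
  is_derive x v (fun z => \det (A z)) (\sum_i \sum_j A' i j * cofactor (A x) i j).
Proof.
move=> dA.
pose B i : 'M[R]_n := \matrix_(a, b) if a == i then A' i b else A x a b.
have dB i : \det (B i) = \sum_j A' i j * cofactor (A x) i j.
  rewrite (expand_det_row _ i); apply: eq_bigr => j _; rewrite mxE eqxx.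
  congr (_ * (_ * \det _)); apply/matrixP => a b; rewrite !mxE.
  by rewrite eq_sym (negbTE (neq_lift _ _)).
under eq_bigr do rewrite -dB.
have -> : \sum_i \det (B i) = \sum_(s : 'S_n) (-1) ^+ s *
    \sum_i A' i (s i) * \prod_(j | j != i) A x j (s j).
  rewrite exchange_big; apply: eq_bigr => s _; rewrite mulr_sumr.
  apply: eq_bigr => i _; congr (_ * _); rewrite (bigD1 i) //= mxE eqxx; congr (_ * _).
  by apply: eq_bigr => j ji; rewrite mxE (negbTE ji).
rewrite [X in is_derive _ _ X](_ : _ = \sum_(s : 'S_n)
   (fun z => (-1) ^+ s * \prod_i A z i (s i))); last first.
  by apply/funext => z; rewrite fct_sumE.
elim/big_ind2 : _ => [|f1 d1 f2 d2 h1 h2|s _]; first exact: is_derive_cst.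
  exact: is_deriveD.
apply: is_deriveZ.
have := @is_derive_prod V _ (index_enum _) (fun i z => A z i (s i)) (fun i => A' i (s i)) x v (index_enum_uniq _).
by apply.
Qed.

End LinearAlgebra.

(** * Linear differential equations on a box *)

Section Box.
Context {R : realType} {n : nat}.
Implicit Types (x y z : 'rV[R]_n) (F G : 'rV[R]_n -> R).

(** A ball of the sup norm, by coordinates: moving one coordinate of a point to
    that of another point of the box does not leave the box. *)
Definition box (x0 : 'rV[R]_n) (rho : R) : set 'rV[R]_n :=
  [set x | forall i, `|x 0 i - x0 0 i| < rho].

Notation e_ k := (delta_mx 0 k : 'rV[R]_n).

Lemma add_deltaE x (t : R) k i : (x + t *: e_ k) 0 i = x 0 i + t * (i == k)%:R.
Proof. by rewrite !mxE eqxx. Qed.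

Lemma box_update x0 rho x k t : box x0 rho x -> `|x 0 k + t - x0 0 k| < rho ->
  box x0 rho (x + t *: e_ k).
Proof.
move=> bx bt i; rewrite add_deltaE.
by have [->|_] := eqVneq i k; rewrite ?mulr1 ?mulr0 ?addr0.
Qed.

Lemma affine_on_line F k a x (t : R) :
  (forall s : R, Num.min t 0 <= s <= Num.max t 0 -> is_derive (x + s *: e_ k) (e_ k) F a) ->
  F (x + t *: e_ k) = F x + t * a.
Proof.
move=> dF; pose v s : 'rV[R]_1 := \row__ F (x + s *: e_ k).
have := @mvt_norm R 1 v (fun=> \row__ a) (\row__ a) 0 t 0.
have hyp (s : R) : Num.min t 0 <= s <= Num.max t 0 ->
    is_derive s (1 : R) v (\row__ a) /\ `|\row_(_ < 1) a - \row_(_ < 1) a| <= 0.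
  move=> sI; rewrite subrr normr0; split=> //.
  apply/is_derive_rowP => i; rewrite mxE.
  by under [X in is_derive _ _ X]eq_fun do rewrite mxE; exact/is_derive_line/dF.
move=> /(_ hyp); rewrite mul0r normr_le0 subr0 => /eqP/rowP/(_ 0).
by rewrite !mxE scale0r addr0; lra.
Qed.

Lemma box_segment x0 rho x k (t s : R) : box x0 rho x -> box x0 rho (x + t *: e_ k) ->
  Num.min t 0 <= s <= Num.max t 0 -> box x0 rho (x + s *: e_ k).
Proof.
move=> bx bt; rewrite ge_min le_max => /andP[/orP s1 /orP s2].
apply: box_update => //.
have := bx k; have := bt k; rewrite add_deltaE eqxx mulr1 !ltr_norml.
by case: s1 => ?; case: s2 => ?; lra.
Qed.

Lemma affine_on_box x0 rho F k a x t : box x0 rho x -> box x0 rho (x + t *: e_ k) ->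
  (forall y, box x0 rho y -> (forall i, i != k -> y 0 i = x 0 i) ->
     is_derive y (e_ k) F a) ->
  F (x + t *: e_ k) = F x + t * a.
Proof.
move=> bx bt dF; apply: affine_on_line => s sI; apply: dF.
  exact: box_segment bt sI.
by move=> i ik; rewrite add_deltaE (negbTE ik) mulr0 addr0.
Qed.

(** Two points of the box are joined by changing one coordinate at a time. *)
Lemma depends_only x0 rho (S : pred 'I_n) F :
  (forall x k, box x0 rho x -> ~~ S k -> is_derive x (e_ k) F 0) ->
  forall x y, box x0 rho x -> box x0 rho y ->
  (forall k, S k -> x 0 k = y 0 k) -> F x = F y.
Proof.
move=> dF x y; have [m] := ubnP #|[pred k | x 0 k != y 0 k]|.
elim: m x => // m IH x mx bx yb xy.
have [|/existsP/=[k xk]] := boolP [forall k, x 0 k == y 0 k].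
  by move=> /forallP xye; congr F; apply/rowP => i; exact/eqP/xye.
pose x' := x + (y 0 k - x 0 k) *: e_ k.
have bx' : box x0 rho x' by apply: box_update => //; rewrite subrKC; exact: yb.
have Sk : ~~ S k by apply: contra xk => /xy/eqP.
have x'E i : x' 0 i = if i == k then y 0 k else x 0 i.
  rewrite /x' add_deltaE; have [->|_] := eqVneq i k; first by rewrite mulr1 subrKC.
  by rewrite mulr0 addr0.
have -> : F x = F x'.
  rewrite -[LHS]addr0 -(mulr0 (y 0 k - x 0 k)); apply/esym.
  by apply: (affine_on_box bx bx') => z bz _; exact: dF.
apply: IH => //; last first.
  by move=> i Si; rewrite x'E; case: eqVneq => [->//|_]; exact: xy.
rewrite -ltnS; apply: leq_trans mx; rewrite ltnS; apply: proper_card.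
apply/properP; split; last by exists k; rewrite !inE // x'E !eqxx.
apply/fintype.subsetP => i; rewrite !inE x'E.
by have [->|] := eqVneq i k; rewrite ?eqxx.
Qed.

(** When [x] and [y] have the same [k]-th coordinate, [F] agrees along the two
    segments in direction [e_k], hence so do its derivatives; [F] need not be twice
    differentiable. *)
Lemma derivative_depends_only x0 rho k F G :
  (forall x i, box x0 rho x -> is_derive x (e_ i) F ((i == k)%:R * G x)) ->
  forall x y, box x0 rho x -> box x0 rho y -> x 0 k = y 0 k -> G x = G y.
Proof.
move=> dF x y bx yb xy.
have dFk z : box x0 rho z -> is_derive (0 : R) (1 : R) (fun s : R => F (z + s *: e_ k)) (G z).
  move=> bz; apply: is_derive_line; rewrite scale0r addr0.
  by have := dF z k bz; rewrite eqxx mul1r.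
apply: is_derive_unique (dFk x bx) _.
apply: near_eq_is_derive (dFk y yb).
have r0 : 0 < rho - `|x 0 k - x0 0 k| by rewrite subr_gt0.
have r2 : 0 < (rho - `|x 0 k - x0 0 k|) / 2 by rewrite divr_gt0.
have H := @near_dist_le R R 0 _ r2.
near=> s.
have sr : `|s| <= (rho - `|x 0 k - x0 0 k|) / 2.
  by rewrite -normrN -sub0r; near: s; exact: H.
have bs z : box x0 rho z -> z 0 k = x 0 k -> box x0 rho (z + s *: e_ k).
  move=> bz zx; apply: box_update => //; rewrite zx addrAC.
  by apply: le_lt_trans (ler_normD _ _) _; lra.
apply: (@depends_only x0 rho (pred1 k) F); [|exact: bs|exact: bs|].
  by move=> z i bz /= ik; have := dF z i bz; rewrite (negbTE ik) mul0r.
by move=> i /= /eqP ->; rewrite !add_deltaE xy.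
Unshelve. all: by end_near. Qed.

Lemma box_center x0 rho : 0 < rho -> box x0 rho x0.
Proof. by move=> r0 i; rewrite subrr normr0. Qed.

(** The component [V k], hence also the multiplier [lam], depends on [x_k] alone, for
    every [k]; with two coordinates the multiplier is constant. *)
Lemma conformal_jacobian_affine x0 rho (V : 'I_n -> 'rV[R]_n -> R) lam :
  (2 <= n)%N -> 0 < rho ->
  (forall x k i, box x0 rho x -> is_derive x (e_ i) (V k) ((i == k)%:R * lam x)) ->
  forall x, box x0 rho x -> forall k, V k x = V k x0 + lam x0 * (x 0 k - x0 0 k).
Proof.
move=> n2 r0 dV.
have b0 := box_center x0 r0.
pose k0 : 'I_n := Ordinal (ltnW n2); pose k1 : 'I_n := Ordinal n2.
have lamk k := @derivative_depends_only x0 rho k (V k) lam (fun x i => dV x k i).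
have lamc x : box x0 rho x -> lam x = lam x0.
  move=> bx; pose z := x0 + (x 0 k0 - x0 0 k0) *: e_ k0.
  have bz : box x0 rho z by apply: box_update => //; rewrite subrKC; exact: bx.
  rewrite (lamk k0 x z) //; last by rewrite /z add_deltaE eqxx mulr1 subrKC.
  by rewrite (lamk k1 z x0) // /z add_deltaE mulr0 addr0.
move=> x bx k.
pose z := x0 + (x 0 k - x0 0 k) *: e_ k.
have bz : box x0 rho z by apply: box_update => //; rewrite subrKC; exact: bx.
rewrite (@depends_only x0 rho (pred1 k) (V k) _ x z) //.
- rewrite mulrC; apply: (affine_on_box b0 bz) => y yb _.
  by have := dV y k k yb; rewrite eqxx mul1r lamc.
- by move=> y i yb /= ik; have := dV y k i yb; rewrite (negbTE ik) mul0r.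
- by move=> i /= /eqP ->; rewrite /z add_deltaE eqxx mulr1 subrKC.
Qed.

(** The diagonal entries show that [w j] depends on [x_j] alone.  For [i != j] the
    entry [sg i j] is affine in [x_i] with slope [w j] and in [x_j] with slope [w i];
    computing its increment along the two paths around a rectangle shows that the
    increments of [w i] and of [w j] grow at one common rate [c].  So [w] is affine
    and [sg] quadratic. *)
Lemma metrisability_quadratic x0 rho (sg : 'I_n -> 'I_n -> 'rV[R]_n -> R)
    (w : 'I_n -> 'rV[R]_n -> R) :
  (2 <= n)%N -> 0 < rho ->
  (forall x i j k, box x0 rho x -> is_derive x (e_ k) (sg i j)
     ((k == i)%:R * w j x + (k == j)%:R * w i x)) ->
  exists (b : 'rV[R]_n) (c : R), forall x, box x0 rho x -> forall i j,
    sg i j x = sg i j x0 + b 0 i * (x 0 j - x0 0 j) + (x 0 i - x0 0 i) * b 0 j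
       + c * (x 0 i - x0 0 i) * (x 0 j - x0 0 j).
Proof.
move=> n2 r0 dsg.
have b0 := box_center x0 r0.
have wdep j : forall x y, box x0 rho x -> box x0 rho y -> x 0 j = y 0 j -> w j x = w j y.
  move=> x y bx yb xy; apply: (mulfI (x := 2)) => //.
  apply: (@derivative_depends_only x0 rho j (sg j j) (fun x => 2 * w j x)) => // z i bz.
  by refine (is_derive_eq (dsg z j j i bz) _); ring.
have bst i j s t : i != j -> `|s| < rho -> `|t| < rho ->
    box x0 rho (x0 + s *: e_ i + t *: e_ j).
  move=> ij sr tr; apply: box_update; first by apply: box_update => //; rewrite addrAC subrr add0r.
  by rewrite add_deltaE eq_sym (negbTE ij) mulr0 addr0 addrAC subrr add0r.
have b1 i s : `|s| < rho -> box x0 rho (x0 + s *: e_ i).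
  by move=> sr; apply: box_update => //; rewrite addrAC subrr add0r.
have step i j s x : i != j -> box x0 rho x -> box x0 rho (x + s *: e_ i) ->
    sg i j (x + s *: e_ i) = sg i j x + s * w j x.
  move=> ij bx bs; apply: (affine_on_box bx bs) => y yb yx.
  have := dsg y i j i yb; rewrite eqxx (negbTE ij) mul1r mul0r addr0.
  by rewrite (wdep j y x) // yx // eq_sym.
have step' i j s x : i != j -> box x0 rho x -> box x0 rho (x + s *: e_ j) ->
    sg i j (x + s *: e_ j) = sg i j x + s * w i x.
  move=> ij bx bs; apply: (affine_on_box bx bs) => y yb yx.
  have := dsg y i j j yb; rewrite eqxx eq_sym (negbTE ij) mul1r mul0r add0r.
  by rewrite (wdep i y x) // yx.
have cross i j s t : i != j -> `|s| < rho -> `|t| < rho ->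
    s * (w j (x0 + t *: e_ j) - w j x0) = t * (w i (x0 + s *: e_ i) - w i x0).
  move=> ij sr tr.
  have h1 := step' i j t (x0 + s *: e_ i) ij (b1 i s sr) (bst i j s t ij sr tr).
  have h2 := step i j s x0 ij b0 (b1 i s sr).
  have bji : box x0 rho (x0 + t *: e_ j + s *: e_ i) by apply: bst => //; rewrite eq_sym.
  have h3 := step i j s (x0 + t *: e_ j) ij (b1 j t tr) bji.
  have h4 := step' i j t x0 ij b0 (b1 j t tr).
  rewrite addrAC in h3; lra.
pose r2 := rho / 2.
have r20 : 0 < r2 by rewrite divr_gt0.
have r2r : `|r2| < rho by rewrite gtr0_norm // /r2; lra.
pose cc j := (w j (x0 + r2 *: e_ j) - w j x0) / r2.
have ccE j : w j (x0 + r2 *: e_ j) - w j x0 = r2 * cc j by rewrite /cc; field; rewrite gt_eqF.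
have ccij i j : cc i = cc j.
  have [->//|ij] := eqVneq i j.
  have := cross i j r2 r2 ij r2r r2r; rewrite !ccE.
  by move=> /(mulfI (lt0r_neq0 r20))/(mulfI (lt0r_neq0 r20)).
pose k0 : 'I_n := Ordinal (ltnW n2); pose k1 : 'I_n := Ordinal n2.
pose c := cc k0.
have wE j x : box x0 rho x -> w j x = w j x0 + c * (x 0 j - x0 0 j).
  move=> bx; pose t := x 0 j - x0 0 j.
  have tr : `|t| < rho by exact: bx.
  rewrite (wdep j x (x0 + t *: e_ j)) //; last 2 first.
  - exact: b1.
  - by rewrite add_deltaE eqxx mulr1 subrKC.
  have [i ij] : exists i : 'I_n, i != j.
    have [->|j0] := eqVneq j k0; first by exists k1.
    by exists k0; rewrite eq_sym.
  have := cross i j r2 t ij r2r tr; rewrite ccE (ccij i k0) -/c -/t.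
  rewrite mulrCA => /(mulfI (lt0r_neq0 r20)); lra.
exists (\row_j w j x0), c => x bx i j.
pose u l (y : 'rV[R]_n) : R := y 0 l - x0 0 l.
have du k l z : is_derive z (e_ k) (u l) ((k == l)%:R).
  have -> : (k == l)%:R = (e_ k) 0 l - 0 :> R by rewrite subr0 mxE eqxx eq_sym.
  have /is_derive_rowP/(_ l) dl := @is_derive_id R 'rV[R]_n z (e_ k).
  exact: is_deriveB dl (is_derive_cst (x0 0 l) z (e_ k)).
pose q := (w i x0 *: u j + w j x0 *: u i) + c *: (u i * u j).
have qE y : q y = w i x0 * u j y + w j x0 * u i y + c * (u i y * u j y) by [].
have dq y k : is_derive y (e_ k) q
    (w i x0 * (k == j)%:R + w j x0 * (k == i)%:R +
      c * (u i y * (k == j)%:R + u j y * (k == i)%:R)).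
  have d1 := is_deriveD (is_deriveZ (w i x0) (du k j y)) (is_deriveZ (w j x0) (du k i y)).
  exact: is_deriveD d1 (is_deriveZ c (is_deriveM (du k i y) (du k j y))).
have dsq y k : box x0 rho y -> ~~ pred0 k -> is_derive y (e_ k) (sg i j - q) 0.
  move=> yb _; refine (is_derive_eq (is_deriveB (dsg y i j k yb) (dq y k)) _).
  by rewrite (wE i y) // (wE j y) // /u; ring.
have : sg i j x - q x = sg i j x0 - q x0.
  by apply: (@depends_only x0 rho pred0 (sg i j - q) dsq x x0 bx b0) => k.
rewrite !qE /u !subrr !mxE; lra.
Qed.

End Box.

(** * The metric and the field where geodesics are straight *)

Section Local.
Context {R : realType}.

Lemma is_derive_line0 (V W : normedModType R) (f : V -> W) (x v : V) df :
  is_derive (0 : R) (1 : R) (fun s => f (x + s *: v)) df -> is_derive x v f df.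
Proof.
move=> [d1 d2].
have E : (fun h : R => h^-1 *: (((fun s => f (x + s *: v)) \o shift 0) (h *: (1 : R))
    - f (x + (0 : R) *: v))) = (fun h => h^-1 *: ((f \o shift x) (h *: v) - f x)).
  apply/funext => h /=; congr (_ *: (f _ - f _)).
    by rewrite [h *: _]mulr1 addr0 addrC.
  by rewrite scale0r addr0.
by apply: DeriveDef; [move: d1; rewrite /derivable E|move: d2; rewrite /derive E].
Qed.

Lemma is_derive_chain (V : normedModType R) (f : V -> R) (g : R -> R) x v df dg :
  is_derive x v f df -> is_derive (f x) (1 : R) g dg ->
  is_derive x v (fun y => g (f y)) (dg * df).
Proof.
move=> dfx dgx; apply: is_derive_line0.
apply: (@is_derive1_comp R g (fun s => f (x + s *: v))); first by rewrite scale0r addr0.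
by apply: is_derive_line; rewrite scale0r addr0.
Qed.

Lemma is_derive_bigsum (V : normedModType R) m (f : 'I_m -> V -> R) f' x v :
  (forall i, is_derive x v (f i) (f' i)) ->
  is_derive x v (fun z => \sum_i f i z) (\sum_i f' i).
Proof.
move=> df; rewrite (_ : (fun z => _) = \sum_i f i); first exact: is_derive_sum.
by apply/funext => z; rewrite fct_sumE.
Qed.

Lemma is_derive_mul (V : normedModType R) (f g : V -> R) x v df dg :
  is_derive x v f df -> is_derive x v g dg ->
  is_derive x v (fun z => f z * g z) (f x * dg + g x * df).
Proof. exact: is_deriveM. Qed.

Lemma is_derive_partial n (U : set 'rV[R]_n) (f : 'rV[R]_n -> R) x k :
  diff_times 1 U f -> U x -> is_derive x (delta_mx 0 k) f (partial k f x).
Proof. by move=> [df _] Ux; apply/derivableP/diff_derivable/df. Qed.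

Lemma posdef_det_gt0 n (A : 'M[R]_n) : A^T = A ->
  (forall y, y != 0 -> 0 < quad A y) -> 0 < \det A.
Proof.
move=> As pA; have [C Cu /(congr1 determinant)] := posdef_orthonormal As pA.
rewrite !det_mulmx det_tr det1 mulrAC -expr2 => E.
have C0 : 0 < \det C ^+ 2.
  by rewrite exprn_even_gt0 //= -unitfE -unitmxE.
by rewrite -(pmulr_rgt0 _ C0) E.
Qed.

Section Structure.
Context {n : nat} (H : 'rV[R]_n -> 'M[R]_n) (U : set 'rV[R]_n) (x0 : 'rV[R]_n)
  (psi : 'I_n -> 'rV[R]_n -> R).
Context (n2 : (2 <= n)%N) (oU : open U) (Ux0 : U x0) (sH : smooth_on U H)
  (symH : forall x, U x -> (H x)^T = H x)
  (posH : forall x, U x -> forall y, y != 0 -> 0 < quad (H x) y)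
  (dH : forall x, U x -> forall k i j, partial k (fun z => H z i j) x =
    2 * psi k x * H x i j + psi i x * H x k j + psi j x * H x i k).

(** This is [e^f] for the potential [f] of [psi] with [f x0 = 0]. *)
Definition scale_factor x : R :=
  expR ((ln (\det (H x)) - ln (\det (H x0))) / (2 * n.+1%:R)).

Let K x := invmx (H x).

Let uH x : U x -> H x \in unitmx. Proof. by move=> Ux; exact/posdef_unitmx/posH. Qed.

Let detH x : U x -> 0 < \det (H x).
Proof. by move=> Ux; apply: posdef_det_gt0; [exact: symH|exact: posH]. Qed.

Let dHe x k i j : U x -> is_derive x (delta_mx 0 k) (fun z => H z i j)
  (2 * psi k x * H x i j + psi i x * H x k j + psi j x * H x i k).
Proof.
move=> Ux; rewrite -dH //; apply: (is_derive_partial (U := U)) => //.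
exact: diff_times_entry.
Qed.

Let Ksym x i j : U x -> K x i j = K x j i.
Proof. by move=> Ux; rewrite /K -{1}(symH Ux) -trmx_inv mxE. Qed.

Let HK x i j : U x -> \sum_k H x i k * K x k j = (i == j)%:R.
Proof. by move=> Ux; have /matrixP/(_ i j) := mulmxV (uH Ux); rewrite !mxE. Qed.

Lemma scale_factor_gt0 x : 0 < scale_factor x.
Proof. exact: expR_gt0. Qed.

Lemma scale_factor_det x : U x ->
  scale_factor x ^+ (2 * n.+1) * \det (H x0) = \det (H x).
Proof.
move=> Ux; rewrite -expRM_natl natrM.
have -> (a : R) : 2 * n.+1%:R * (a / (2 * n.+1%:R)) = a.
  by rewrite mulrC divfK // mulf_neq0 // pnatr_eq0.
by rewrite expRB !lnK ?posrE ?detH // divfK // gt_eqF // detH.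
Qed.

(** In Jacobi's formula the three terms of [dH] contribute [2 n psi_k], [psi_k] and
    [psi_k] to the logarithmic derivative of the determinant. *)
Lemma is_derive_scale_factor x k : U x ->
  is_derive x (delta_mx 0 k) scale_factor (psi k x * scale_factor x).
Proof.
move=> Ux.
have dd : is_derive x (delta_mx 0 k) (fun z => \det (H z))
    (2 * n.+1%:R * psi k x * \det (H x)).
  pose E : 'M[R]_n := \matrix_(i, j) (2 * psi k x * H x i j + psi i x * H x k j + psi j x * H x i k).
  have dE i j : is_derive x (delta_mx 0 k) (fun z => H z i j) (E i j).
    by rewrite mxE; exact: dHe.
  refine (is_derive_eq (is_derive_det dE) _).
  have cof i j : cofactor (H x) i j = \det (H x) * K x i j.
    by rewrite Ksym // /K /invmx uH // !mxE mulrA mulfV ?mul1r // gt_eqF // detH.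
  have tr i j : \sum_k0 H x i k0 * K x j k0 = (i == j)%:R.
    by rewrite -(HK i j Ux); apply: eq_bigr => l _; rewrite [K x j l]Ksym.
  have S2 : \sum_i psi i x * (\sum_j H x k j * K x i j) = psi k x.
    under eq_bigr do rewrite tr.
    rewrite (bigD1 k) //= eqxx mulr1 big1 ?addr0 // => i ik.
    by rewrite eq_sym (negbTE ik) mulr0.
  have S3 : \sum_i \sum_j psi j x * (H x i k * K x i j) = psi k x.
    rewrite exchange_big -[RHS]S2 /=; apply: eq_bigr => i _; rewrite mulr_sumr; apply: eq_bigr => j _.
    by rewrite [K x j i]Ksym // -{1}(symH Ux) mxE.
  have S1 : \sum_i \sum_j H x i j * K x i j = n%:R.
    by under eq_bigr do rewrite tr eqxx; rewrite sumr_const card_ord.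
  transitivity (\sum_i \sum_j (2 * psi k x * \det (H x) * (H x i j * K x i j) +
      \det (H x) * (psi i x * (H x k j * K x i j)) +
      \det (H x) * (psi j x * (H x i k * K x i j)))).
    by apply: eq_bigr => i _; apply: eq_bigr => j _; rewrite mxE cof; ring.
  under eq_bigr do rewrite !big_split /= -!mulr_sumr.
  by rewrite !big_split /= -!mulr_sumr S1 S2 S3 -natr1; ring.
have dl := is_derive_chain dd (is_derive1_ln (detH Ux)).
rewrite /scale_factor.
pose f z : R := (ln (\det (H z)) - ln (\det (H x0))) / (2 * n.+1%:R).
have df : is_derive x (delta_mx 0 k) f (psi k x).
  pose g (z : 'rV[R]_n) : R := (2 * n.+1%:R)^-1 * (ln (\det (H z)) - ln (\det (H x0))).
  have -> : f = g by apply/funext => z; rewrite /f mulrC.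
  refine (is_derive_eq (is_deriveZ (2 * n.+1%:R)^-1
    (is_deriveB dl (is_derive_cst (ln (\det (H x0))) x (delta_mx 0 k)))) _).
  rewrite subr0 -[_ *: _]/(_ * _).
  by field; rewrite gt_eqF ?detH // nat1r pnatr_eq0.
by refine (is_derive_eq (is_derive_chain df (is_derive_expR (f x))) _); rewrite mulrC.
Qed.

Let dK x k i j : U x -> is_derive x (delta_mx 0 k) (fun z => K z i j)
  (- (2 * psi k x * K x i j) - (k == j)%:R * (\sum_a psi a x * K x a i)
    - (k == i)%:R * (\sum_a psi a x * K x a j)).
Proof.
move=> Ux.
have dKe a b : is_derive x (delta_mx 0 k) (fun z => K z a b) (partial k (fun z => K z a b) x).
  apply: (is_derive_partial (U := U)) => //; apply: diff_times_invmx => // c d.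
  exact: diff_times_entry.
pose D := \matrix_(a, b) partial k (fun z => K z a b) x.
pose E : 'M[R]_n := \matrix_(a, b) (2 * psi k x * H x a b + psi a x * H x k b + psi b x * H x a k).
(* The derivative of [H K = 1]. *)
have DE : H x *m D + E *m K x = 0.
  apply/matrixP => a b.
  have ds : is_derive x (delta_mx 0 k) (fun z => \sum_c H z a c * K z c b)
      (\sum_c (H x a c * D c b + K x c b * E a c)).
    apply: is_derive_bigsum => c; rewrite !mxE.
    exact: is_derive_mul (dHe k a c Ux) (dKe c b).
  have h : \sum_c (H x a c * D c b + K x c b * E a c) = 0.
    apply: near_cst_is_derive ds.
    apply: (near_eq_on_open (g := fun=> (a == b)%:R : R) oU) => // y Uy.
    by rewrite HK.
  rewrite [LHS]mxE [X in X + _]mxE [X in _ + X]mxE [RHS]mxE -big_split -[RHS]h.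
  by apply: eq_bigr => c _; rewrite [K x c b * _]mulrC.
have DKE : D = - (K x *m E *m K x).
  apply/eqP; rewrite -subr_eq0 opprK -(mulKmx (uH Ux) D) -mulmxA -mulmxDr DE.
  by rewrite mulmx0.
refine (is_derive_eq (dKe i j) _).
have -> : partial k (fun z => K z i j) x = D i j by rewrite mxE.
pose p : 'rV[R]_n := \row_a psi a x.
have EE : E = (2 * psi k x) *: H x + p^T *m row k (H x) + (row k (H x))^T *m p.
  apply/matrixP => a b; rewrite !mxE !big_ord1 !mxE.
  congr (_ + _); rewrite mulrC; congr (_ * _).
  by rewrite -[in LHS](symH Ux) mxE.
have rK : row k (H x) *m K x = delta_mx 0 k by rewrite -row_mul mulmxV ?uH // row1.
have KTK : (K x)^T = K x by apply/matrixP => a b; rewrite mxE Ksym.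
have rKT : K x *m (row k (H x))^T = (delta_mx 0 k)^T.
  by rewrite -{1}KTK -trmx_mul rK.
rewrite DKE EE !mulmxDr !mulmxDl -scalemxAr mulVmx ?uH // -scalemxAl mul1mx.
rewrite [K x *m (p^T *m _)]mulmxA -[_ *m row k (H x) *m K x]mulmxA rK.
rewrite [K x *m ((row k (H x))^T *m p)]mulmxA rKT -[_ *m p *m K x]mulmxA.
rewrite -{2}KTK -trmx_mul.
have pK a : (p *m K x) 0 a = \sum_c psi c x * K x c a.
  by rewrite mxE; apply: eq_bigr => c _; rewrite mxE.
rewrite !mxE !big_ord1 !mxE -!pK !mxE !eqxx /= [j == k]eq_sym [i == k]eq_sym; ring.
Qed.

(** In the derivative of the rescaled inverse metric the terms in [2 psi_k] cancel,
    which leaves the equation of [metrisability_quadratic]. *)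
Lemma inverse_metric_quadratic rho : 0 < rho -> box x0 rho `<=` U ->
  exists (b : 'rV[R]_n) (c : R), forall x, box x0 rho x ->
    scale_factor x ^+ 2 *: invmx (H x) =
    invmx (H x0) + (x - x0)^T *m b + b^T *m (x - x0) + c *: ((x - x0)^T *m (x - x0)).
Proof.
move=> r0 bU.
pose sg i j x := (scale_factor x * scale_factor x) * K x i j.
pose w j x := - (scale_factor x ^+ 2 * \sum_a psi a x * K x a j).
have [x i j k bx|b [c E]] := @metrisability_quadratic R n x0 rho sg w n2 r0.
  have Ux := bU _ bx.
  have dS := is_derive_scale_factor k Ux.
  refine (is_derive_eq (is_derive_mul (is_derive_mul dS dS) (dK k i j Ux)) _).
  by rewrite /w; ring.
exists b, c => x bx; apply/matrixP => i j.
have S0 : scale_factor x0 = 1 by rewrite /scale_factor subrr mul0r expR0.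
have := E x bx i j; rewrite /sg S0 mul1r mul1r -expr2 !mxE !big_ord1 !mxE => ->.
by rewrite /K; ring.
Qed.

(** Lowering an index of the Jacobian of [W], its symmetric part is given by the Lie
    derivative of the metric and its antisymmetric part by the closed dual form.
    Together they make the Jacobian equal to [s 1 - psi (x) W], and the scale
    factor absorbs the second term. *)
Lemma conformal_field_affine (W : 'rV[R]_n -> 'rV[R]_n) (c : 'rV[R]_n -> R) rho :
  smooth_on U W ->
  (forall x, U x -> forall i j,
    \sum_k (W x 0 k * partial k (fun z => H z i j) x
          + H x k j * partial i (fun z => W z 0 k) x
          + H x i k * partial j (fun z => W z 0 k) x) = 2 * c x * H x i j) ->
  (forall x, U x -> forall i j,
    partial i (fun z => \sum_k H z k j * W z 0 k) x =
    partial j (fun z => \sum_k H z k i * W z 0 k) x) ->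
  0 < rho -> box x0 rho `<=` U ->
  exists (a : 'rV[R]_n) (l : R), forall x, box x0 rho x ->
    scale_factor x *: W x = a + l *: (x - x0).
Proof.
move=> sW lieW clW r0 bU.
pose s x := c x - \sum_k psi k x * W x 0 k.
have dWe x k i : U x -> is_derive x (delta_mx 0 i) (fun z => W z 0 k)
    (partial i (fun z => W z 0 k) x).
  move=> Ux; apply: (is_derive_partial (U := U)) => //.
  exact: diff_times_entry.
have dW x k i : U x -> partial i (fun z => W z 0 k) x = (i == k)%:R * s x - psi i x * W x 0 k.
  move=> Ux.
  pose B i j := \sum_k H x k j * partial i (fun z => W z 0 k) x.
  pose om j := \sum_k H x k j * W x 0 k.
  pose pW := \sum_k psi k x * W x 0 k.
  have Hs a b : H x a b = H x b a by rewrite -[in LHS](symH Ux) mxE.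
  have dom a b : partial a (fun z => \sum_k H z k b * W z 0 k) x =
      B a b + 2 * psi a x * om b + pW * H x a b + psi b x * om a.
    have [_ dE] : is_derive x (delta_mx 0 a) (fun z => \sum_k H z k b * W z 0 k)
      (\sum_k (H x k b * partial a (fun z => W z 0 k) x + W x 0 k *
        (2 * psi a x * H x k b + psi k x * H x a b + psi b x * H x k a))).
      by apply: is_derive_bigsum => l; exact: is_derive_mul (dHe a l b Ux) (dWe x l a Ux).
    rewrite [LHS]dE.
    rewrite /B /om /pW !mulr_sumr mulr_suml -!big_split /=.
    by apply: eq_bigr => l _; ring.
  have cl a b : B a b - B b a = psi b x * om a - psi a x * om b.
    have := clW x Ux a b; rewrite !dom (Hs b a); lra.
  have lie a b : B a b + B b a + 2 * pW * H x a b + psi a x * om b + psi b x * om a =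
      2 * c x * H x a b.
    rewrite -lieW // /B /om /pW !mulr_sumr mulr_suml -!big_split /=.
    by apply: eq_bigr => l _; rewrite dH // (Hs l a) (Hs l b); ring.
  pose P : 'M[R]_n := \matrix_(a, b) (partial a (fun z => W z 0 b) x + psi a x * W x 0 b).
  (* [cl] and [lie] determine [B], and [B] is [P - psi^T W] times the metric. *)
have PH : P *m H x = s x *: H x.
    apply/matrixP => a b; rewrite !mxE.
    transitivity (B a b + psi a x * om b).
      rewrite /B /om mulr_sumr -big_split /=.
      by apply: eq_bigr => l _; rewrite mxE; ring.
    by have := cl a b; have := lie a b; rewrite /s -/pW; lra.
  have : P = s x *: 1%:M.
    by rewrite -(mulmxK (uH Ux) P) PH -scalemxAl mulmxV // uH.
  move=> /matrixP/(_ i k); rewrite !mxE => E.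
  by rewrite -[LHS](addrK (psi i x * W x 0 k)) E mulrC.
pose V k x := scale_factor x * W x 0 k.
have affV := @conformal_jacobian_affine R n x0 rho V (fun x => scale_factor x * s x) n2 r0.
exists (scale_factor x0 *: W x0), (scale_factor x0 * s x0) => x bx.
apply/rowP => k; rewrite !mxE; apply: affV bx k => y k i yb.
have Uy := bU _ yb.
refine (is_derive_eq (is_derive_mul (is_derive_scale_factor i Uy) (dWe y k i Uy)) _).
by rewrite dW //; ring.
Qed.

End Structure.
End Local.

(** * Projective normal form *)

Section Klein.
Context {R : realType} {n : nat}.
Implicit Types (x y z u b beta : 'rV[R]_n) (C : 'M[R]_n).

Lemma dotpE x y : x *m y^T = (dotp x y)%:M.
Proof.
rewrite [LHS]mx11_scalar mxE; congr _%:M.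
by apply: eq_bigr => i _; rewrite mxE.
Qed.

Lemma dotpC x y : dotp x y = dotp y x.
Proof. by apply: eq_bigr => i _; rewrite mulrC. Qed.

Lemma dotpDl x y z : dotp (x + y) z = dotp x z + dotp y z.
Proof. by rewrite /dotp -big_split; apply: eq_bigr => i _; rewrite mxE mulrDl. Qed.

Lemma dotpZl t x y : dotp (t *: x) y = t * dotp x y.
Proof. by rewrite /dotp mulr_sumr; apply: eq_bigr => i _; rewrite mxE mulrA. Qed.

Lemma dotpZr t x y : dotp x (t *: y) = t * dotp x y.
Proof. by rewrite dotpC dotpZl dotpC. Qed.

Lemma enorm_sqr x : enorm x ^+ 2 = dotp x x.
Proof. by rewrite sqr_sqrtr // sumr_ge0 // => i _; rewrite -expr2 sqr_ge0. Qed.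

Definition klein_den (mu : R) x : R := 1 + mu * dotp x x.

(** The metric of constant curvature [mu] in projective coordinates. *)
Definition klein_mx (mu : R) x : 'M[R]_n :=
  (klein_den mu x) ^- 2 *: ((klein_den mu x)%:M - mu *: (x^T *m x)).

Definition klein_inv (mu : R) x : 'M[R]_n :=
  klein_den mu x *: (1%:M + mu *: (x^T *m x)).

Lemma klein_mxK mu x : klein_den mu x != 0 -> klein_mx mu x *m klein_inv mu x = 1%:M.
Proof.
move=> D0; rewrite /klein_mx /klein_inv -scalemxAl -scalemxAr scalerA.
have -> : ((klein_den mu x)%:M - mu *: (x^T *m x)) *m (1%:M + mu *: (x^T *m x)) =
    (klein_den mu x)%:M.
  have e : (x^T *m x) *m (x^T *m x) = dotp x x *: (x^T *m x).
    by rewrite mulmxA -[_ *m x *m x^T]mulmxA dotpE mul_mx_scalar -scalemxAl.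
  rewrite mulmxDr mulmx1 mulmxBl mul_scalar_mx -!scalemxAl -!scalemxAr e.
  by apply/matrixP => i j; rewrite !mxE !big_ord1 /klein_den; ring.
rewrite scale_scalar_mx; congr _%:M.
by rewrite /klein_den in D0 *; field.
Qed.

Section Projective.
Context (C : 'M[R]_n) (beta : 'rV[R]_n) (mu : R) (y : 'rV[R]_n).
Let q := 1 + dotp beta y.
Let z := q^-1 *: y.
Let L : 'M[R]_n := 1%:M + beta^T *m y.

Lemma projective_factor : q != 0 -> z *m L = y.
Proof.
move=> q0; rewrite mulmxDr mulmx1 mulmxA dotpE mul_scalar_mx dotpZl [dotp y _]dotpC.
by apply/rowP => i; rewrite !mxE; move: q0; rewrite /q => q0; field.
Qed.

(** Completing the square: [L^T L] accounts for the linear terms and for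
    [dotp beta beta], and [z L = y] turns the rest into a multiple of [z^T z]. *)
Lemma quadratic_factor : q != 0 ->
  1%:M + y^T *m beta + beta^T *m y + (mu + dotp beta beta) *: (y^T *m y) =
  L^T *m (1%:M + mu *: (z^T *m z)) *m L.
Proof.
move=> q0; rewrite mulmxDr mulmxDl mulmx1 -scalemxAr -scalemxAl.
rewrite (mulmxA L^T) -trmx_mul -mulmxA projective_factor //.
have -> : L^T = 1%:M + y^T *m beta by rewrite /L linearD /= tr_scalar_mx trmx_mul trmxK.
rewrite /L mulmxDl mul1mx mulmxDr mulmx1.
rewrite mulmxA -[_ *m beta *m beta^T]mulmxA dotpE mul_mx_scalar -scalemxAl scalerDl.
by apply/matrixP => i j; rewrite !mxE !big_ord1 !mxE; ring.
Qed.

Lemma det_quadratic_factor :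
  \det (L^T *m (1%:M + mu *: (z^T *m z)) *m L) = q ^+ 2 * klein_den mu z.
Proof.
have dL : \det L = q by rewrite det_add_rank1 dotpE mxE eqxx mulr1n dotpC.
rewrite !det_mulmx det_tr dL scalemxAr det_add_rank1 -scalemxAl dotpE !mxE eqxx mulr1n.
by rewrite /klein_den; ring.
Qed.

End Projective.

(** The derivative at [z] of the change of coordinates [z |-> x0 + z C / (1 - beta.z)],
    expressed with [y = z / (1 - beta.z)]. *)
Definition projective_jacobian C beta y : 'M[R]_n :=
  (1 + dotp beta y) *: ((1%:M + beta^T *m y) *m C).

(* [u] is the displacement from the centre, [y] its coordinates in the frame [C],
   and [z] the projective coordinate; [h] and [h0] are the metrics at the point and
   at the centre. *)
Context (h h0 C : 'M[R]_n) (u b beta y z : 'rV[R]_n) (c mu S q : R).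
Context (hu : h \in unitmx) (Cu : C \in unitmx) (Ch : C *m h0 *m C^T = 1%:M)
  (h0p : 0 < \det h0) (Sp : 0 < S)
  (hE : S ^+ 2 *: invmx h = invmx h0 + u^T *m b + b^T *m u + c *: (u^T *m u))
  (hdet : S ^+ (2 * n.+1) * \det h0 = \det h)
  (uE : u = y *m C) (bE : b = beta *m C) (muE : mu = c - dotp beta beta)
  (qE : q = 1 + dotp beta y) (qp : 0 < q) (zE : z = q^-1 *: y).

Let L : 'M[R]_n := 1%:M + beta^T *m y.
Let sg : 'M[R]_n := L^T *m (1%:M + mu *: (z^T *m z)) *m L.

Let inv_h0 : invmx h0 = C^T *m C.
Proof.
have h0u : h0 \in unitmx by rewrite unitmxE unitfE gt_eqF.
have E : C^T *m C *m h0 = 1%:M by rewrite -mulmxA; exact: mulmx1C.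
by rewrite -[RHS](mulmxK h0u) E mul1mx.
Qed.

Let hsg : S ^+ 2 *: invmx h = C^T *m sg *m C.
Proof.
rewrite hE inv_h0 uE bE /sg zE qE -quadratic_factor; last by rewrite -qE gt_eqF.
rewrite !trmx_mul -[mu + _]/(mu + _) muE subrK.
by rewrite !mulmxDr !mulmxDl mulmx1 -!scalemxAr -!scalemxAl !mulmxA.
Qed.

(** The determinant of the inverse metric is known from [hdet], and that of the
    quadratic expression from its factorisation; the dimension cancels. *)
Lemma klein_scale : (S ^+ 2)^-1 = q ^+ 2 * klein_den mu z.
Proof.
have dsg : \det sg = q ^+ 2 * klein_den mu z.
  by rewrite /sg zE qE det_quadratic_factor.
have := congr1 determinant hsg.
rewrite detZ det_mulmx [\det (C^T *m sg)]det_mulmx dsg det_tr det_inv -hdet.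
have dC : \det C ^+ 2 * \det h0 = 1.
  by have := congr1 determinant Ch; rewrite !det_mulmx det_tr det1 => <-; ring.
have S0 : S != 0 by rewrite gt_eqF.
have h00 : \det h0 != 0 by rewrite gt_eqF.
have -> : \det C * (q ^+ 2 * klein_den mu z) * \det C = \det C ^+ 2 * (q ^+ 2 * klein_den mu z).
  by ring.
move=> E; have : (S ^+ 2)^-1 = \det C ^+ 2 * \det h0 * (q ^+ 2 * klein_den mu z).
  rewrite mulrAC -E mulnS exprD [S ^+ (2 * n)]exprM.
  have T0 : S ^+ 2 ^+ n != 0 by rewrite !expf_neq0.
  by move: (S ^+ 2 ^+ n) T0 => T T0; field; rewrite h00 T0 S0.
by rewrite dC mul1r.
Qed.

Lemma klein_den_gt0 : 0 < klein_den mu z.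
Proof.
have : 0 < q ^+ 2 * klein_den mu z by rewrite -klein_scale invr_gt0 exprn_gt0.
by rewrite pmulr_rgt0 // exprn_gt0.
Qed.

Let J := projective_jacobian C beta y.

Let JNJ : J^T *m klein_inv mu z *m J = invmx h.
Proof.
have S0 : S ^+ 2 != 0 by rewrite expf_neq0 // gt_eqF.
have JE : J = q *: (L *m C) by rewrite /J /projective_jacobian -qE.
have JT : J^T = q *: (C^T *m L^T).
  by rewrite JE; apply/matrixP => i j; rewrite -trmx_mul !mxE.
rewrite -[RHS]scale1r -(mulVf S0) -scalerA hsg klein_scale JT JE /klein_inv /sg.
rewrite -!scalemxAl -!scalemxAr -!scalemxAl !scalerA !mulmxA; congr (_ *: _).
by ring.
Qed.

Lemma klein_jacobian_unit : J \in unitmx.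
Proof.
have : J^T *m klein_inv mu z *m J \in unitmx by rewrite JNJ unitmx_inv.
by rewrite unitmx_mul => /andP[].
Qed.

(** By [klein_scale] the factorised inverse metric equals [J^T N J] for the inverse
    [N] of the model metric, with no factor left over. *)
Lemma klein_metric : J *m h *m J^T = klein_mx mu z.
Proof.
have Ju := klein_jacobian_unit.
have D0 : klein_den mu z != 0 by rewrite gt_eqF // klein_den_gt0.
have E : J *m h *m J^T *m klein_inv mu z = 1%:M.
  apply: (can_inj (mulmxK Ju)); rewrite mul1mx -!mulmxA (mulmxA J^T) JNJ.
  by rewrite mulmxV // mulmx1.
have NK : klein_inv mu z *m klein_mx mu z = 1%:M by apply: mulmx1C; exact: klein_mxK.
by rewrite -[LHS]mulmx1 -NK mulmxA E mul1mx.
Qed.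

(** [(l z + a) L] is affine in [y], since [z L = y]; the scalar factor of the
    Jacobian and the scale factor combine to the square root by [klein_scale]. *)
Lemma klein_field (w0 w a0 : 'rV[R]_n) l0 : w *m J = w0 ->
  S *: w0 = a0 + l0 *: u ->
  let a := a0 *m invmx C in
  w = Num.sqrt (klein_den mu z) *: ((l0 - dotp a beta) *: z + a).
Proof.
move=> wJ w0E a; set D := klein_den mu z.
have D0 : 0 < D := klein_den_gt0.
have Ju := klein_jacobian_unit.
apply: (can_inj (mulmxK Ju)); rewrite wJ.
have S0 : S != 0 by rewrite gt_eqF.
have Si : S^-1 = q * Num.sqrt D.
  apply/eqP; rewrite -(@eqrXn2 _ 2) // ?invr_ge0 ?mulr_ge0 ?sqrtr_ge0 ?ltW //.
  by rewrite exprMn sqr_sqrtr ?ltW // exprVn klein_scale.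
have -> : w0 = S^-1 *: (a0 + l0 *: u) by rewrite -w0E scalerA mulVf // scale1r.
rewrite Si /J /projective_jacobian -qE -/L -scalemxAl -scalemxAr scalerA mulrC.
congr (_ *: _); rewrite mulmxDl -scalemxAl (mulmxA z) (mulmxA a).
have -> : z *m L = y by rewrite zE qE projective_factor // -qE gt_eqF.
rewrite uE /L mulmxDr mulmx1 mulmxA dotpE mul_scalar_mx mulmxDl /a mulmxKV //.
by rewrite -scalemxAl addrCA -scalerDl subrK.
Qed.

End Klein.

Section KleinFormulas.
Context {R : realType} {n : nat} (mu l : R) (a x : 'rV[R]_n).
Let D := klein_den mu x.
Context (Dp : 0 < D).

Lemma klein_norm (y : 'rV[R]_n) : Num.sqrt (quad (klein_mx mu x) y) =
  Num.sqrt (D * enorm y ^+ 2 - mu * dotp x y ^+ 2) / D.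
Proof.
have -> : quad (klein_mx mu x) y = (D * enorm y ^+ 2 - mu * dotp x y ^+ 2) * D ^- 2.
  rewrite quadE /klein_mx -scalemxAr -scalemxAl mulmxBr mulmxBl mul_mx_scalar.
  rewrite -scalemxAl dotpE -scalemxAr -scalemxAl mulmxA -[_ *m x *m y^T]mulmxA !dotpE.
  rewrite mul_scalar_mx !mxE !eqxx !mulr1n enorm_sqr [dotp y x]dotpC -/D; ring.
rewrite mulrC sqrtrM ?invr_ge0 ?exprn_ge0 ?ltW // -exprVn sqrtr_sqr mulrC.
by rewrite ger0_norm // invr_ge0 ltW.
Qed.

Lemma klein_flat (w y : 'rV[R]_n) : w = Num.sqrt D *: (l *: x + a) ->
  \sum_j (\sum_i klein_mx mu x i j * w 0 i) * y 0 j =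
  (l * dotp x y + D * dotp a y - mu * dotp a x * dotp x y) / D `^ (3 / 2).
Proof.
move=> wE.
have -> : \sum_j (\sum_i klein_mx mu x i j * w 0 i) * y 0 j = dotp (w *m klein_mx mu x) y.
  apply: eq_bigr => j _; rewrite mxE; congr (_ * _).
  by apply: eq_bigr => i _; rewrite mulrC.
have -> : w *m klein_mx mu x = (Num.sqrt D * D ^- 2) *:
    (D *: (l *: x + a) + (- mu * dotp (l *: x + a) x) *: x).
  rewrite wE /klein_mx -scalemxAr -scalemxAl scalerA mulrC mulmxBr mul_mx_scalar.
  by rewrite -scalemxAr mulmxA dotpE mul_scalar_mx scalerA mulNr scaleNr.
have -> : D `^ (3 / 2) = Num.sqrt D ^+ 3.
  by rewrite -powR_mulrn ?sqrtr_ge0 // -powR12_sqrt ?ltW // -powRrM mulrC.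
have sD : Num.sqrt D != 0 by rewrite sqrtr_eq0 -ltNge.
have DE : D = Num.sqrt D ^+ 2 by rewrite sqr_sqrtr // ltW.
rewrite dotpZl dotpDl !dotpZl !dotpDl !dotpZl.
have xx : mu * dotp x x = Num.sqrt D ^+ 2 - 1 by rewrite -DE /D /klein_den addrC addKr.
rewrite [X in _ * X](_ : _ = l * dotp x y * (D - mu * dotp x x) + D * dotp a y
    - mu * dotp a x * dotp x y); last by ring.
by move: (Num.sqrt D) sD DE xx => s s0 DE xx; rewrite xx DE; field.
Qed.

End KleinFormulas.

(** * Change of chart *)

Section Charts.
Context {R : realType} {n : nat}.

Lemma open_preimage_on (T T' : topologicalType) (f : T -> T') (A : set T) (O : set T') :
  open A -> (forall x, A x -> {for x, continuous f}) -> open O ->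
  open (A `&` f @^-1` O).
Proof.
move=> oA cf oO; rewrite openE => x [Ax Ox]; apply: filterI.
  exact: open_nbhs_nbhs.
by apply: cf => //; exact: open_nbhs_nbhs.
Qed.

Section OneChart.
Context {M : topologicalType} (phi : chart R n M).

Lemma cfun_continuous_at m : cdom phi m -> {for m, continuous (cfun phi)}.
Proof.
move=> dm; have := @cfun_continuous _ _ _ phi.
by rewrite (continuous_open_subspace _ (@cdom_open _ _ _ phi)); apply; rewrite inE.
Qed.

Lemma cinv_continuous_at x : cimg phi x -> {for x, continuous (cinv phi)}.
Proof.
move=> ix; have := @cinv_continuous _ _ _ phi.
by rewrite (continuous_open_subspace _ (@cimg_open _ _ _ phi)); apply; rewrite inE.
Qed.

Lemma cimg_cinv x : cimg phi x -> cdom phi (cinv phi x) /\ cfun phi (cinv phi x) = x.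
Proof. by move=> [m dm <-]; rewrite cfunK. Qed.

Lemma open_cfun_image (O : set M) : open O -> open (cfun phi @` (cdom phi `&` O)).
Proof.
move=> oO.
have -> : cfun phi @` (cdom phi `&` O) = cimg phi `&` (cinv phi @^-1` O).
  apply/seteqP; split=> [x [m [dm Om] <-]|x [ix Ox]].
    by split; [exists m|rewrite /= cfunK].
  by have [d E] := cimg_cinv ix; exists (cinv phi x).
by apply: open_preimage_on => //; [exact: cimg_open|exact: cinv_continuous_at].
Qed.

End OneChart.

Lemma open_overlap (M : topologicalType) (phi psi : chart R n M) : open (overlap phi psi).
Proof. by apply: open_cfun_image; exact: cdom_open. Qed.

Lemma within_continuous_open (T T' : topologicalType) (f : T -> T') (A : set T) :
  open A -> (forall x, A x -> {for x, continuous f}) -> {within A, continuous f}.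
Proof.
by move=> oA cf; rewrite continuous_open_subspace // => x; rewrite inE; exact: cf.
Qed.

(** The transition maps of the new chart are those of [phi0] composed with [P] or
    [Q], hence smooth. *)
Lemma recoordinate (M : manifold R n) (phi0 : chart R n M) (B B' : set 'rV[R]_n)
    (P Q : 'rV[R]_n -> 'rV[R]_n) :
  local_coords phi0 -> open B -> open B' -> B `<=` cimg phi0 ->
  (forall x, B x -> B' (P x) /\ Q (P x) = x) ->
  (forall z, B' z -> B (Q z) /\ P (Q z) = z) ->
  smooth_on B P -> smooth_on B' Q ->
  exists phi : chart R n M, [/\ local_coords phi,
    forall m, cdom phi0 m -> B (cfun phi0 m) -> cdom phi m,
    cimg phi = B' &
    forall z, B' z -> transition phi phi0 z = Q z /\ overlap phi phi0 z].
Proof.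
move=> lc oB oB' Bi PB QB sP sQ.
have cP x : B x -> {for x, continuous P} by exact: (sP 0%N).
have cQ z : B' z -> {for z, continuous Q} by exact: (sQ 0%N).
pose D := cdom phi0 `&` cfun phi0 @^-1` B.
have oD : open D.
  by apply: open_preimage_on => //; [exact: cdom_open|exact: cfun_continuous_at].
pose f := P \o cfun phi0; pose g := cinv phi0 \o Q.
have imD : f @` D = B'.
  apply/seteqP; split=> [z [m [dm Bm] <-]|z Bz]; first by have [] := PB _ Bm.
  have [BQ PQ] := QB z Bz; have [dm mE] := cimg_cinv (Bi _ BQ).
  exists (cinv phi0 (Q z)); first by split => //=; rewrite mE.
  by rewrite /f /= mE.
have oimD : open (f @` D) by rewrite imD.
have cf : {within D, continuous f}.
  apply: (@within_continuous_open _ _ f D oD) => m [dm Bm].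
  apply: (@continuous_comp _ _ _ (cfun phi0) P); first exact: cfun_continuous_at.
  exact: cP.
have cg : {within f @` D, continuous g}.
  have cg z : B' z -> {for z, continuous g}.
    move=> Bz; apply: (@continuous_comp _ _ _ Q (cinv phi0)); first exact: cQ.
    by apply: cinv_continuous_at; apply: Bi; have [] := QB z Bz.
  by rewrite imD; exact: (@within_continuous_open _ _ g B' oB' cg).
have fK m : D m -> g (f m) = m.
  by move=> [dm Bm]; rewrite /g /f /=; have [_ ->] := PB _ Bm; rewrite cfunK.
pose phi := Chart oD oimD cf cg fK.
have ci : cimg phi = B' by exact: imD.
exists phi; split=> //; last first.
  move=> z Bz; have [BQ PQ] := QB z Bz; have [dm mE] := cimg_cinv (Bi _ BQ).
  split; first by rewrite /transition /= mE.
  have : cimg phi z by rewrite ci.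
  by move=> [m [dm' Bm] <-]; exists m.
move=> psi apsi; have [s1 s2] := lc psi apsi; split=> k.
- have sub z : overlap phi psi z -> B' z /\ overlap phi0 psi (Q z).
    move=> [m [[dm Bm] dpsi] <-]; rewrite /= /f /=.
    by have [? ->] := PB _ Bm; split => //; exists m.
  apply: (@diff_times_comp_row _ _ _ _ k (overlap phi psi) (overlap phi0 psi) Q
    (transition phi0 psi)).
  + exact: open_overlap.
  + exact: open_overlap.
  + by move=> z /sub[].
  + by apply: diff_times_sub (sQ k) => z /sub[].
  + exact: s1.
- have sub z : overlap psi phi z -> overlap psi phi0 z /\ B (transition psi phi0 z).
    move=> [m [dpsi [dm Bm]] <-]; split; first by exists m.
    by rewrite /transition cfunK.
  apply: (@diff_times_comp_row _ _ _ _ k (overlap psi phi) B (transition psi phi0) P).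
  + exact: open_overlap.
  + exact: oB.
  + by move=> z /sub[].
  + by apply: diff_times_sub (s2 k) => z /sub[].
  + exact: sP.
Qed.

End Charts.

Section Projective.
Context {R : realType} {n : nat}.
Implicit Types (x y z beta : 'rV[R]_n).

Definition projective_map beta y : 'rV[R]_n := (1 + dotp beta y)^-1 *: y.

Definition halfspace beta : set 'rV[R]_n := [set y | 0 < 1 + dotp beta y].

Definition affine_map a (B : 'M[R]_n) x : 'rV[R]_n := a + x *m B.

Lemma projective_map_den beta y : halfspace beta y ->
  1 + dotp (- beta) (projective_map beta y) = (1 + dotp beta y)^-1.
Proof.
rewrite /halfspace /= => q0; rewrite dotpZr -scaleN1r dotpZl.
by field; rewrite gt_eqF.
Qed.

Lemma projective_mapK beta y : halfspace beta y ->
  projective_map (- beta) (projective_map beta y) = y.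
Proof.
move=> q0; rewrite {1}/projective_map projective_map_den // invrK scalerA.
by rewrite mulfV ?scale1r // gt_eqF.
Qed.

Lemma projective_map_halfspace beta y : halfspace beta y ->
  halfspace (- beta) (projective_map beta y).
Proof. by move=> q0; rewrite /halfspace /= projective_map_den // invr_gt0. Qed.

Lemma smooth_dotp k beta : diff_times k [set: 'rV[R]_n] (fun y => 1 + dotp beta y).
Proof.
apply: diff_times_add; first exact: openT.
  exact: diff_times_cst.
apply: diff_times_sum => [|i]; first exact: openT.
apply: diff_times_mul; [exact: openT|exact: diff_times_cst|exact: diff_times_coord].
Qed.

Lemma open_halfspace beta : open (halfspace beta).
Proof.
have := @open_preimage_on _ _ (fun y => 1 + dotp beta y) [set: 'rV[R]_n]
  [set t : R | 0 < t] openT.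
rewrite setTI; apply; last exact: open_gt.
exact: (smooth_dotp 0 beta).
Qed.

Lemma smooth_projective_map beta : smooth_on (halfspace beta) (projective_map beta).
Proof.
move=> k; have oH := @open_halfspace beta.
apply: diff_times_row => // i.
under [X in diff_times _ _ X]eq_fun do rewrite mxE.
apply: diff_times_mul => //; last exact: diff_times_coord.
apply: diff_times_inv => //; first by move=> y; rewrite /halfspace /= => /gt_eqF ->.
by apply: diff_times_sub (smooth_dotp k beta).
Qed.

Lemma smooth_affine_map a B : smooth_on [set: 'rV[R]_n] (affine_map a B).
Proof.
move=> k; apply: diff_times_row => [|i]; first exact: openT.
under [X in diff_times _ _ X]eq_fun do rewrite !mxE.
apply: diff_times_add; [exact: openT|exact: diff_times_cst|].
apply: diff_times_sum => [|j]; first exact: openT.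
apply: diff_times_mul; [exact: openT|exact: diff_times_coord|exact: diff_times_cst].
Qed.

Lemma smooth_comp (U U' : set 'rV[R]_n) (f g : 'rV[R]_n -> 'rV[R]_n) : open U -> open U' ->
  (forall x, U x -> U' (f x)) -> smooth_on U f -> smooth_on U' g -> smooth_on U (g \o f).
Proof.
move=> oU oU' fU sf sg k.
exact: (@diff_times_comp_row _ _ _ _ k U U' f g).
Qed.

Lemma jacobian_eq (f : 'rV[R]_n -> 'rV[R]_n) z (J : 'M[R]_n) :
  differentiable f z -> (forall v, is_derive z v f (v *m J)) -> 'J f z = J.
Proof.
move=> df H; apply/row_matrixP => i; rewrite !rowE.
by rewrite -deriveEjacobian //; have [_] := H (delta_mx 0 i).
Qed.

(** Stated for a map equal to [Q] near [z], because a transition map has arbitrary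
    values off the image of the chart. *)
Lemma jacobian_projective x0 (C : 'M[R]_n) beta z : halfspace (- beta) z ->
  let Q := affine_map x0 C \o projective_map (- beta) in
  forall f : 'rV[R]_n -> 'rV[R]_n, (\near z, f z = Q z) ->
  'J f z = projective_jacobian C beta (projective_map (- beta) z).
Proof.
move=> Hz Q f fQ.
have sQ : smooth_on (halfspace (- beta)) Q.
  apply: (smooth_comp (U' := setT)) => //.
  - exact: open_halfspace.
  - exact: openT.
  - exact: smooth_projective_map.
  - exact: smooth_affine_map.
have [dQ _] := sQ 1%N.
have Qf : \near z, Q z = f z by apply: filterS fQ.
apply: jacobian_eq; first exact: near_eq_differentiable Qf (dQ z Hz).
move=> v; apply: near_eq_is_derive Qf _.
pose r y := 1 + dotp (- beta) y.
have rz : r z != 0 by rewrite gt_eqF.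
have dcoord i : is_derive z v (fun y : 'rV[R]_n => y 0 i : R) (v 0 i).
  by have /is_derive_rowP/(_ i) := @is_derive_id R 'rV[R]_n z v.
have dr : is_derive z v r (dotp (- beta) v).
  have d0 : is_derive z v (fun y => dotp (- beta) y) (dotp (- beta) v).
    have di i : is_derive z v (fun y : 'rV[R]_n => (- beta) 0 i * y 0 i) ((- beta) 0 i * v 0 i).
      refine (is_derive_eq (is_derive_mul (is_derive_cst ((- beta) 0 i : R) z v) (dcoord i)) _).
      by rewrite mulr0 addr0.
    exact: is_derive_bigsum di.
  by refine (is_derive_eq (is_deriveD (is_derive_cst (1 : R) z v) d0) _); rewrite add0r.
have dri : is_derive z v (fun y => (r y)^-1) (- (r z) ^- 2 * dotp (- beta) v).
  have [d1 d2] := dr.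
  by apply: DeriveDef; [exact: derivableV|rewrite deriveV // d2].
apply/is_derive_rowP => i.
have -> : (fun y => Q y 0 i) = (fun y => x0 0 i + \sum_j ((r y)^-1 * y 0 j) * C j i).
  apply/funext => y; rewrite /Q /affine_map /projective_map /= mxE [X in _ + X]mxE.
  by congr (_ + _); apply: eq_bigr => j _; rewrite mxE.
have ds : is_derive z v (fun y => \sum_j ((r y)^-1 * y 0 j) * C j i)
   (\sum_j ((r z)^-1 * v 0 j + z 0 j * (- (r z) ^- 2 * dotp (- beta) v)) * C j i).
  have dj j : is_derive z v (fun y => ((r y)^-1 * y 0 j) * C j i)
      (((r z)^-1 * v 0 j + z 0 j * (- (r z) ^- 2 * dotp (- beta) v)) * C j i).
    refine (is_derive_eq (is_derive_mul (is_derive_mul dri (dcoord j))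
      (is_derive_cst (C j i : R) z v)) _).
    by rewrite mulr0 add0r mulrC.
  exact: is_derive_bigsum dj.
refine (is_derive_eq (is_deriveD (is_derive_cst (x0 0 i : R) z v) ds) _).
rewrite add0r /projective_jacobian -scalemxAr mulmxA mulmxDr mulmx1 mulmxA dotpE.
rewrite mul_scalar_mx [RHS]mxE [X in _ = _ * X]mxE [RHS]mulr_sumr; apply: eq_bigr => j _.
have -> : 1 + dotp beta (projective_map (- beta) z) = (r z)^-1.
  by have := projective_map_den Hz; rewrite opprK.
have -> : dotp (- beta) v = - dotp beta v by rewrite -scaleN1r dotpZl mulN1r.
rewrite !mxE -/(r z) [dotp v beta]dotpC.
by field.
Qed.

End Projective.

(** * The classification *)

Lemma chris_sym {R : realType} n (H : 'rV[R]_n -> 'M[R]_n) (U : set 'rV[R]_n) x k i j :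
  open U -> (forall y, U y -> (H y)^T = H y) -> U x ->
  chris H x k i j = chris H x k j i.
Proof.
move=> oU sH Ux; congr (_ * _); apply: eq_bigr => l _; congr (_ * (_ - _)).
  by rewrite addrC.
apply: near_eq_derive; apply: (near_eq_on_open oU) => // y Uy.
by rewrite -[in RHS](sH y Uy) mxE.
Qed.

(** Every tangent vector is the velocity of a geodesic, which is straight; so the
    quadratic map of the symbols sends it to a parallel vector. *)
Lemma straight_geodesics_symbols {R : realType} {n : nat} {M : manifold R n}
    (h : riemannian_metric M) (phi : chart R n M) :
  local_coords phi -> (forall I g, geodesic h phi I g -> straight (g @` I)) ->
  forall x, cimg phi x -> forall k a b,
    chris (h phi) x k a b = (k == a)%:R * (chris (h phi) x b b b / 2)
                          + (k == b)%:R * (chris (h phi) x a a a / 2).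
Proof.
move=> lc st x Ux; have oU := @cimg_open _ _ _ phi.
apply: projective_symbols => [k i j|y k l].
  exact: (chris_sym k i j oU (Defs.metric_sym h lc) Ux).
have uH z : cimg phi z -> h phi z \in unitmx.
  by move=> Uz; apply: posdef_unitmx; exact: metric_posdef Uz.
have [T [g [w [T0 g0 w0 gw]]]] :=
  geodesic_exists y oU (metric_smooth h lc) uH Ux.
pose I := [set t : R | `|t| < T].
have oI : open I.
  have -> : I = ball (0 : R) T.
    by apply/seteqP; split => t; rewrite /I /= -ball_normE /= sub0r normrN.
  exact: ball_open.
have gE t : I t -> derive1 g t = w t.
  by move=> It; have [_ [_ dg] _] := gw t It; rewrite derive1E.
have dg1 t : I t -> is_derive t (1 : R) (derive1 g)
    (\row_k - \sum_i \sum_j chris (h phi) (g t) k i j * w t 0 i * w t 0 j).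
  move=> It; have [_ _ dw] := gw t It; apply: near_eq_is_derive dw.
  by apply: (near_eq_on_open oI) => // s Is; rewrite gE.
have geo : geodesic h phi I g.
  split=> //.
    move=> s t Is It r /andP[sr rt]; move: Is It; rewrite /I /= !ltr_norml; lra.
  move=> t It; have [Ug dg dw] := gw t It; have dg1t := dg1 t It.
  split=> // m.
  have -> : derive1n 2 g t = derive1 (derive1 g) t by [].
  by rewrite derive1E; have [_ ->] := dg1t; rewrite mxE gE // addNr.
have dw0 : is_derive (0 : R) (1 : R) w
    (\row_k - \sum_i \sum_j chris (h phi) x k i j * y 0 i * y 0 j).
  by have [_ _] := gw 0 (ltac:(by rewrite normr0)); rewrite g0 w0.
have := straight_acceleration k l T0 (st I g geo) (fun t It => let: And3 _ d _ := gw t It in d) dw0.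
by rewrite w0 !mxE !mulrN => /oppr_inj.
Qed.

Theorem lemma9p1 (R : realType) (n : nat) (M : manifold R n)
    (h : riemannian_metric M) (W : vector_field M) :
  (2 <= n)%N ->
  locally_projectively_flat h ->
  conformal h W ->
  closed_form (flat h W) ->
  forall p : M, exists (phi : chart R n M) (mu lambda : R) (a : 'rV[R]_n),
    [/\ local_coords phi, cdom phi p &
      forall x, cimg phi x ->
      [/\ 0 < 1 + mu * enorm x ^+ 2,
          forall y, metric_norm h phi x y =
            Num.sqrt ((1 + mu * enorm x ^+ 2) * enorm y ^+ 2
                      - mu * dotp x y ^+ 2)
            / (1 + mu * enorm x ^+ 2),
          W phi x = Num.sqrt (1 + mu * enorm x ^+ 2) *: (lambda *: x + a) &
          forall y, flat_eval h W phi x y =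
            (lambda * dotp x y + (1 + mu * enorm x ^+ 2) * dotp a y
             - mu * dotp a x * dotp x y)
            / (1 + mu * enorm x ^+ 2) `^ (3 / 2)]].
Proof.
move=> n2 hflat [cf Wconf] Wclosed p.
have [phi0 [lc dp st]] := hflat p.
pose H := h phi0; pose x0 := cfun phi0 p.
have oU := @cimg_open _ _ _ phi0.
have Ux0 : cimg phi0 x0 by exists p.
have symH := Defs.metric_sym h lc; have posH := metric_posdef h lc.
have sH := metric_smooth h lc.
have symb := straight_geodesics_symbols lc st.
pose psi b x := chris H x b b b / 2.
have dH x (Ux : cimg phi0 x) := @projective_metric_derivative R n H (cimg phi0) x
  (psi^~ x) oU Ux symH (posdef_unitmx (posH x Ux)) (symb x Ux).
(* The integration takes place on a box around the coordinates of [p]. *)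
have [rho r0 bU] : exists2 rho, 0 < rho & box x0 rho `<=` cimg phi0.
  have Hn : nbhs x0 (cimg phi0) by exact: open_nbhs_nbhs.
  have /nbhs_ballP[e e0 eP] := Hn; exists e => // x bx; apply: eP.
  by split=> // i j; rewrite !ord1 /ball /= distrC; exact: bx.
have obox : open (box x0 rho).
  have -> : box x0 rho = ball x0 rho.
    apply/seteqP; split=> [x bx|x [_ bx] i].
      by split=> // i j; rewrite !ord1 /ball /= distrC; exact: bx.
    by rewrite distrC; exact: bx.
  exact: ball_open.
have [b [c invE]] := inverse_metric_quadratic n2 oU sH symH posH dH r0 bU.
have [a0 [l0 WE]] := @conformal_field_affine R n H (cimg phi0) x0 psi n2 oU sH symH posH dH
  (W phi0) (fun x => cf (cinv phi0 x)) rho (vfield_smooth W lc)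
  (Wconf phi0 lc) (Wclosed phi0 lc) r0 bU.
have [C Cu Ch] := posdef_orthonormal (symH x0 Ux0) (posH x0 Ux0).
pose beta := b *m invmx C; pose mu := c - dotp beta beta.
(* [P] is the projective map to the new coordinate and [Q] its inverse; [B] and [B']
   are the corresponding open sets. *)
pose A := affine_map (- (x0 *m invmx C)) (invmx C).
have AE x : A x = (x - x0) *m invmx C by rewrite /A /affine_map mulmxBl addrC.
pose P := projective_map beta \o A.
pose Q := affine_map x0 C \o projective_map (- beta).
pose B := box x0 rho `&` A @^-1` halfspace beta.
pose B' := halfspace (- beta) `&` Q @^-1` B.
have sA : smooth_on setT A by exact: smooth_affine_map.
have oHb g : open (halfspace g : set 'rV[R]_n) by exact: open_halfspace.
have oB : open B.
  exact: (@open_preimage_on _ _ A _ _ obox (fun x _ => sA 0%N x I) (oHb beta)).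
have sQ : smooth_on (halfspace (- beta)) Q.
  apply: (@smooth_comp _ _ (halfspace (- beta)) setT) => //; first exact: openT.
    exact: smooth_projective_map.
  exact: smooth_affine_map.
have oB' : open B'.
  exact: (@open_preimage_on _ _ Q _ _ (oHb (- beta)) (sQ 0%N) oB).
have QA z : A (Q z) = projective_map (- beta) z.
  by rewrite AE /Q /= /affine_map addrAC subrr add0r mulmxK.
have QP x : halfspace beta (A x) -> Q (P x) = x.
  move=> Hx; rewrite /Q /P /= projective_mapK // /affine_map AE mulmxKV //.
  by rewrite addrC subrK.
have PB x : B x -> B' (P x) /\ Q (P x) = x.
  move=> [bx Hx]; have QPx := QP x Hx; split=> //; split; last by rewrite /= QPx.
  exact: projective_map_halfspace.
have QB z : B' z -> B (Q z) /\ P (Q z) = z.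
  move=> [Hz BQ]; split=> //; rewrite /P /= QA.
  by have := projective_mapK Hz; rewrite opprK.
have sP : smooth_on B P.
  apply: (@smooth_comp _ _ B (halfspace beta)) => //.
  - by move=> x [].
  - by move=> k; apply: diff_times_sub (sA k).
  - exact: smooth_projective_map.
have sQ' : smooth_on B' Q by move=> k; apply: diff_times_sub (sQ k) => z [].
have [|phi [lcp dphi ciE trE]] := recoordinate lc oB oB' _ PB QB sP sQ'.
  by move=> x [/bU].
pose a := a0 *m invmx C.
exists phi, mu, (l0 - dotp a beta), a; split=> //.
  apply: dphi => //; split; first exact: box_center.
  rewrite /= AE subrr mul0mx /halfspace /= /dotp big1 ?addr0 // => i _.
  by rewrite [X in _ * X]mxE mulr0.
rewrite ciE => z Bz.
have [[bx Hx] PQz] := QB z Bz; have [tz oz] := trE z Bz.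
set x := Q z in bx Hx PQz tz.
pose y := A x.
have JE : 'J (transition phi phi0) z = projective_jacobian C beta y.
  rewrite /y /x QA; have [Hz _] := Bz.
  apply: jacobian_projective => //.
  exact: (near_eq_on_open oB' (fun z' Bz' => (trE z' Bz').1) Bz).
have uE : x - x0 = y *m C by rewrite /y AE mulmxKV.
have bE : b = beta *m C by rewrite /beta mulmxKV.
have zE : z = (1 + dotp beta y)^-1 *: y by rewrite -[LHS]PQz.
have Ux := bU x bx.
have uHx : H x \in unitmx by exact: posdef_unitmx (posH x Ux).
have dH0 := posdef_det_gt0 (symH x0 Ux0) (posH x0 Ux0).
have Sdet := scale_factor_det Ux0 symH posH Ux.
have Sp := scale_factor_gt0 H x0 x.
have hz : h phi z = klein_mx mu z.
  rewrite (metric_transition h lcp lc oz) /= tz JE.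
  exact: (klein_metric uHx Ch dH0 Sp (invE x bx) Sdet uE bE _ _ Hx zE).
have Dp : 0 < klein_den mu z.
  exact: (klein_den_gt0 Ch dH0 Sp (invE x bx) Sdet uE bE _ _ Hx zE).
have Wz : W phi z = Num.sqrt (klein_den mu z) *: ((l0 - dotp a beta) *: z + a).
  apply: (klein_field uHx Cu Ch dH0 Sp (invE x bx) Sdet uE bE _ _ Hx zE _ (WE x bx)) => //.
  by rewrite -JE -(vfield_transition W lcp lc oz) tz.
rewrite enorm_sqr -/(klein_den mu z); split=> //.
  by move=> v; rewrite /metric_norm hz klein_norm.
by move=> v; rewrite -(klein_flat Dp v Wz) -hz.
Qed.
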